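(* Assume the explicit abc conjecture: whenever $a,b,c$ are pairwise coprime non-zero integers with $a+b=c$, one has $c<N(abc)^{7/4}$, where $N(x)=\prod_{p\mid x}p$. Let $2<s<t$ be integers and let $c>0$ be a fixed positive integer. Consider tuples of integers $(a_1,\dots,a_t,n_1,\dots,n_s)$ with $a_1\geq\cdots\geq a_t\geq 2$, $n_1\geq\cdots\geq n_s\geq 2$ and $a_l\neq n_j$ for all $l,j$, satisfying $$\prod_{l=1}^t a_l!=\prod_{j=1}^s n_j!.$$ Such a solution is trivial if there is a pair $(l,j)$ with $|a_l-n_j|=1$, and nontrivial otherwise. Let $i_2,\dots,i_s$ be distinct elements of $\{2,\dots,t\}$. Put $k_1=n_1-a_1$, $k_j=n_j-a_{i_j}$ for $j=2,\dots,s$, and $k=\max\{k_2,\dots,k_s\}$. Let $\mathcal{N}(c)_{\{i_2,\dots,i_s\}}$ be the set of nontrivial solutions with $n_1>a_1$, $n_j>a_{i_j}$ for $j=2,\dots,s$, and $k/k_1\leq c$. (For such solutions, with $m_1=a_1+1$, $m_j=a_{i_j}+1$ and $\Delta(m,k)=m(m+1)\cdots(m+k-1)$, the equation is equivalent to $\prod_{l\notin\{1,i_2,\dots,i_s\}}a_l!=\prod_{j=1}^s\Delta(m_j,k_j)$.) Then $\mathcal{N}(c)_{\{i_2,\dots,i_s\}}$ is finite. Consequently, the union $\mathcal{N}(c)$ of these sets over all choices of distinct $i_2,\dots,i_s\in\{2,\dots,t\}$ is finite, i.e. the equation $\prod_{l=1}^t a_l!=\prod_{j=1}^s n_j!$ has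 only finitely many solutions in $\mathcal{N}(c)$.
   Context: $N(x)$ denotes the product of the distinct primes dividing the non-zero integer $x$. The ''explicit abc conjecture'' is the hypothesis stated at the beginning of the claim. *)

(* Defs.v *)
From mathcomp Require Import all_boot all_order all_algebra.
Set Implicit Arguments. Unset Strict Implicit. Unset Printing Implicit Defensive.
Import Order.TTheory GRing.Theory Num.Theory.

Definition rad (x : nat) : nat := \prod_(p <- primes x) p.

Definition radz (x : int) : nat := rad `|x|%N.

(* Explicit abc conjecture: for pairwise coprime non-zero integers a,b,c with
   a+b=c, c < N(abc)^(7/4).  Since N(abc) >= 1, the inequality is automatic
   when c <= 0, and for c > 0 it is equivalent to c^4 < N(abc)^7. *)
Definition explicit_abc : Prop :=
  forall a b c : int,
    a != 0 -> b != 0 -> c != 0 ->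
    coprimez a b -> coprimez a c -> coprimez b c ->
    (a + b = c)%R ->
    (0 < c)%R -> (c ^+ 4 < ((radz (a * b * c))%:Z) ^+ 7)%R.

Definition at1 (x : seq nat) (l : nat) : nat := nth 0 x l.-1.

Definition is_solution (s t : nat) (a n : seq nat) : Prop :=
  [/\ size a = t /\ size n = s,
      (forall l, 1 <= l -> l < t -> at1 a l.+1 <= at1 a l) /\ 2 <= at1 a t,
      (forall j, 1 <= j -> j < s -> at1 n j.+1 <= at1 n j) /\ 2 <= at1 n s,
      (forall l j, 1 <= l <= t -> 1 <= j <= s -> at1 a l != at1 n j)
    & \prod_(x <- a) x`! = \prod_(y <- n) y`! ].

Definition nontrivial (s t : nat) (a n : seq nat) : Prop :=
  forall l j, 1 <= l <= t -> 1 <= j <= s ->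
    at1 a l != (at1 n j).+1 /\ at1 n j != (at1 a l).+1.

(* i_2, ..., i_s are distinct elements of {2,...,t} (i given as a function,
   only its values on 2..s matter). *)
Definition valid_indices (s t : nat) (i : nat -> nat) : Prop :=
  (forall j, 2 <= j <= s -> 2 <= i j <= t) /\
  (forall j j', 2 <= j <= s -> 2 <= j' <= s -> i j = i j' -> j = j').

Definition kk1 (a n : seq nat) : nat := at1 n 1 - at1 a 1.
Definition kkj (i : nat -> nat) (a n : seq nat) (j : nat) : nat :=
  at1 n j - at1 a (i j).
Definition kk (s : nat) (i : nat -> nat) (a n : seq nat) : nat :=
  \max_(2 <= j < s.+1) kkj i a n j.

(* membership in N(c)_{i_2,...,i_s}; k/k_1 <= c written as k <= c * k_1
   (k_1 > 0 since n_1 > a_1). *)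
Definition in_Nc_i (s t c : nat) (i : nat -> nat) (a n : seq nat) : Prop :=
  [/\ is_solution s t a n, nontrivial s t a n,
      at1 a 1 < at1 n 1,
      (forall j, 2 <= j <= s -> at1 a (i j) < at1 n j)
    & kk s i a n <= c * kk1 a n].

Definition in_Nc (s t c : nat) (a n : seq nat) : Prop :=
  exists i, valid_indices s t i /\ in_Nc_i s t c i a n.

Definition finite_pairs (P : seq nat -> seq nat -> Prop) : Prop :=
  exists L : seq (seq nat * seq nat), forall a n, P a n -> (a, n) \in L.

(* Main.v *)
Require Import Defs.
From mathcomp Require Import all_boot all_order all_algebra.
From mathcomp Require Import Rstruct.
From mathcomp Require Import classical_sets boolp reals sequences exp.
From mathcomp Require Import lra ring zify.
Set Implicit Arguments. Unset Strict Implicit. Unset Printing Implicit Defensive.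
Import Order.TTheory GRing.Theory Num.Theory.

(** Write [n = n_1], [k = n_1 - a_1] and let [A] be the largest [a_l] whose index
    lies outside [{1, i_2, ..., i_s}].  After cancellation every prime factor of
    the block [(n-k, n]] is at most [A <= n - k], while [A! <= n ^ (C k)] with [C]
    depending only on [s] and [c]; it suffices to bound [n] from these facts.

    - If [k ^ 20 <= n], abc applied to consecutive integers of the block bounds
      the product of their radicals from below by a power [n ^ (c' k)], whereas
      smoothness bounds it from above by [k! * exp (psi A)].  Hence
      [k ln n = O(A)], and [A! <= n ^ (C k)] then bounds [A], so also [n].
    - Otherwise [A = O(k)], and Chebyshev's bounds give [ln (binomial n k) = O(k)],
      that is [n = O(k)].  The block contains no prime, so it remains to know that
      [(x, (1 + e) x]] contains a prime for every [e > 0] and large [x].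

    The last fact is proved in the elementary way.  Selberg's formula is obtained
    from the Tatuzawa-Iseki identity.  Then, following Erdős, assume that
    [(x, e^{6h} x]] always carries a positive proportion of primes but that
    [(x, e^{5h} x]] is nearly free of primes for some large [x].  By Selberg's
    formula [(x/n, e^{5h} x/n]] carries twice the average mass for almost all [n];
    covering by such intervals gives the logarithmic scale a mean density of at
    least [4/3], against Mertens' theorem.  So the width [6h] can be replaced by
    [5h], starting from Chebyshev's bounds at width [ln 4]. *)

(** * Divisor sums, the Möbius and von Mangoldt functions *)

Section DivisorSums.
Local Open Scope ring_scope.
Variable R : realType.
Implicit Types (d m n N p : nat) (f g : nat -> R).

Lemma sum_multiples f d N : (0 < d)%N ->
  \sum_(1 <= n < N.+1 | (d %| n)%N) f n
  = \sum_(1 <= m < (N %/ d).+1) f (d * m)%N.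
Proof.
move=> d0; elim: N => [|N IH]; first by rewrite div0n !big_geq.
rewrite big_mkcond big_nat_recr //= -big_mkcond IH divnS //.
case: (boolP (d %| N.+1)%N) => dN /=; last by rewrite add0n addr0.
rewrite [in RHS]add1n [RHS]big_nat_recr //=; congr (_ + f _).
by have := divnK dN; rewrite divnS // dN add1n mulnC => ->.
Qed.

Lemma sum_divisors_exchange (F : nat -> nat -> R) N :
  \sum_(1 <= n < N.+1) \sum_(1 <= d < N.+1 | (d %| n)%N) F d n
  = \sum_(1 <= d < N.+1) \sum_(1 <= m < (N %/ d).+1) F d (d * m)%N.
Proof.
rewrite (exchange_big_dep predT) //=.
rewrite big_nat_cond [RHS]big_nat_cond; apply: eq_bigr => d.
rewrite andbT => /andP[d0 _]; exact: sum_multiples.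
Qed.

(** A common upper limit [N] is what lets divisor sums over different [n] be exchanged. *)
Lemma sum_divisors_widen f n N : (0 < n <= N)%N ->
  \sum_(1 <= d < N.+1 | (d %| n)%N) f d = \sum_(1 <= d < n.+1 | (d %| n)%N) f d.
Proof.
move=> /andP[n0 nN]; rewrite (@big_cat_nat _ _ _ n.+1) //=.
rewrite [X in _ + X]big_nat_cond [X in _ + X]big_pred0 ?addr0 // => d.
apply/negbTE; apply/negP => /andP[/andP[nd _] /(dvdn_leq n0)].
by rewrite leqNgt nd.
Qed.

Definition moebius n : R :=
  if all (fun p => logn p n == 1)%N (primes n) then (-1) ^+ size (primes n) else 0.

Lemma normr_moebius n : `|moebius n| <= 1.
Proof.
by rewrite /moebius; case: ifP => _; rewrite ?normr0 // normrX normrN1 expr1n.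
Qed.

Lemma moebius1 : moebius 1 = 1.
Proof. by rewrite /moebius /= expr0. Qed.

Lemma moebius_primeM p m : prime p -> (0 < m)%N ->
  moebius (p * m) = if (p %| m)%N then 0 else - moebius m.
Proof.
move=> pp m0; have p0 := prime_gt0 pp.
have lpm q : prime q -> logn q (p * m) = ((q == p) + logn q m)%N.
  by move=> qp; rewrite lognM // logn_prime.
case: ifP => pm.
  rewrite /moebius; case: allP => // /(_ p).
  rewrite mem_primes pp muln_gt0 p0 m0 dvdn_mulr //= lpm // eqxx => /(_ isT).
  by have := logn_gt0 p m; rewrite mem_primes pp m0 pm /=; case: (logn p m).
have pmpm : perm_eq (primes (p * m)) (p :: primes m).
  apply: uniq_perm; rewrite ?primes_uniq //=.
    by rewrite primes_uniq mem_primes pm !andbF.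
  by move=> q; rewrite primesM // primes_prime // !inE.
rewrite /moebius (perm_size pmpm) (perm_all _ pmpm) /=.
rewrite lpm // eqxx lognE pp m0 pm /= exprS mulN1r.
have -> : all (fun q => logn q (p * m) == 1)%N (primes m)
        = all (fun q => logn q m == 1)%N (primes m).
  apply: eq_in_all => q; rewrite mem_primes => /and3P[qp _ qm].
  by rewrite lpm //; case: (eqVneq q p) => // qE; rewrite qE pm in qm.
by case: ifP; rewrite ?oppr0.
Qed.

(** Write [n = p * m] with [p] the least prime factor. The divisors [p * d] contribute [- moebius d]
    if [p] does not divide [d] and 0 otherwise; this cancels the divisors of [n] prime to [p], all
    of which divide [m]. *)
Lemma sum_moebius n : (0 < n)%N ->
  \sum_(1 <= d < n.+1 | (d %| n)%N) moebius d = (n == 1%N)%:R.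
Proof.
case: n => [//|[_|n' _]]; first by rewrite big_mkcond big_nat1 /= moebius1.
set n := n'.+2; set p := pdiv n.
have pp : prime p by apply: pdiv_prime.
have p0 := prime_gt0 pp.
have pn : (p %| n)%N by apply: pdiv_dvd.
set m := (n %/ p)%N; have nE : n = (p * m)%N by rewrite mulnC divnK.
have m0 : (0 < m)%N by rewrite divn_gt0 // dvdn_leq.
rewrite (bigID (fun d => p %| d)%N) /=.
under eq_bigl do rewrite andbC.
rewrite big_mkcondr /= sum_multiples // -/m.
rewrite [X in _ + X = _](_ : _ = \sum_(1 <= d < m.+1 | (d %| m)%N && ~~ (p %| d)%N) moebius d).
  rewrite -big_mkcondr /=.
  under eq_bigl do rewrite nE dvdn_pmul2l //.
  rewrite [X in X + _](_ : _ = - \sum_(1 <= d < m.+1 | (d %| m)%N && ~~ (p %| d)%N) moebius d);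
    first by rewrite addNr.
  rewrite -sumrN big_mkcondr /= [LHS]big_nat_cond [RHS]big_nat_cond.
  apply: eq_bigr => d /andP[/andP[d0 _] _].
  by rewrite moebius_primeM //; case: ifP; rewrite ?oppr0.
have E d : (d %| n)%N && ~~ (p %| d)%N = (d %| m)%N && ~~ (p %| d)%N.
  apply: andb_id2r => pd; rewrite nE Gauss_dvdr //.
  by rewrite coprime_sym prime_coprime.
rewrite (eq_bigl _ _ E) big_mkcondr /= sum_divisors_widen ?m0 -?big_mkcondr //=.
by rewrite leq_divLR // leq_pmulr.
Qed.

Definition mangoldt n : R := if primes n is [:: p] then ln p%:R else 0.

Lemma lnn_ge0 n : 0 <= ln (n%:R : R).
Proof.
by case: n => [|n]; [rewrite ln0 | rewrite ln_ge0 // ler1n].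
Qed.

Lemma ler_lnn m n : (m <= n)%N -> ln (m%:R : R) <= ln n%:R.
Proof.
case: m => [|m] mn; first by rewrite ln0 // lnn_ge0.
by rewrite ler_ln ?posrE ?ltr0n ?ler_nat //; apply: leq_trans mn.
Qed.

Lemma lnnM m n : (0 < m)%N -> (0 < n)%N ->
  ln ((m * n)%N%:R : R) = ln m%:R + ln n%:R.
Proof. by move=> m0 n0; rewrite natrM lnM // posrE ltr0n. Qed.

Lemma mangoldt_ge0 n : 0 <= mangoldt n.
Proof. by rewrite /mangoldt; case: primes => [|p []] //; rewrite lnn_ge0. Qed.

Lemma mangoldt_pX p k : prime p -> mangoldt (p ^ k.+1) = ln p%:R.
Proof. by move=> pp; rewrite /mangoldt primesX // primes_prime. Qed.

Lemma mangoldt_prime p : prime p -> mangoldt p = ln p%:R.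
Proof. by move=> pp; rewrite -(mangoldt_pX 0 pp) expn1. Qed.

Variant mangoldt_spec n : R -> Type :=
  | MangoldtPower p k of prime p & n = (p ^ k.+1)%N : mangoldt_spec n (ln p%:R)
  | MangoldtZero : mangoldt_spec n 0.

Lemma mangoldtP n : mangoldt_spec n (mangoldt n).
Proof.
rewrite /mangoldt; case E : (primes n) => [|p [|q s]]; try by right.
have : p \in primes n by rewrite E inE.
rewrite mem_primes => /and3P[pp n0 pn].
apply: (@MangoldtPower _ p (logn p n).-1) => //.
rewrite prednK; last by rewrite logn_gt0 mem_primes pp n0.
rewrite {1}(prod_prime_decomp n0) prime_decompE E /= big_cons big_nil muln1.
by [].
Qed.

Lemma mangoldt_le n : mangoldt n <= ln n%:R.
Proof.
case: mangoldtP => [p k pp ->|]; last exact: lnn_ge0.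
apply: ler_lnn; rewrite expnS leq_pmulr // expn_gt0 prime_gt0 //.
Qed.

(** Strong induction on [n = p * m]: the divisors of [n] not dividing [m] carry the full power of
    [p], and the only prime power among them is [p ^ (logn p m).+1]. *)
Lemma sum_mangoldt n : (0 < n)%N ->
  \sum_(1 <= d < n.+1 | (d %| n)%N) mangoldt d = ln n%:R.
Proof.
elim/ltn_ind: n => n IH n0; have [n1|n1] := leqP n 1.
  have -> : n = 1%N by lia.
  by rewrite big_mkcond big_nat1 /= ln1.
have := pdiv_prime n1; have := pdiv_dvd n.
move: (pdiv n) => p /dvdnP[m nE] pp; have p0 := prime_gt0 pp.
have m0 : (0 < m)%N by move: n0; rewrite nE muln_gt0 => /andP[].
have mn : (m < n)%N by rewrite nE ltn_Pmulr // prime_gt1.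
rewrite (bigID (fun d => d %| m)%N) /=.
rewrite [X in X + _](_ : _ = ln m%:R).
  rewrite [X in _ + X](_ : _ = ln p%:R).
    by rewrite nE lnnM.
  pose q := (p ^ (logn p m).+1)%N.
  have qn : (q %| n)%N.
    by rewrite pfactor_dvdn // nE lognM // (logn_prime p pp) eqxx addn1.
  have qm : ~~ (q %| m)%N by rewrite pfactor_dvdn // ltnn.
  rewrite big_mkcond (bigD1_seq q) ?iota_uniq //=; last first.
    by rewrite mem_index_iota ltnS /q expn_gt0 p0 /= dvdn_leq.
  rewrite qn qm /= mangoldt_pX // big1 ?addr0 // => d dq.
  case: ifP => // /andP[dn dm]; case: mangoldtP => // r k rp dE.
  case/negP: dq; apply/eqP; rewrite dE.
  have [rE|rNp] := eqVneq r p.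
    rewrite rE; congr (_ ^ _)%N.
    move: dn dm; rewrite dE rE !pfactor_dvdn // nE lognM // (logn_prime p pp) eqxx.
    by lia.
  case/negP: dm; move: dn; rewrite dE nE Gauss_dvdl //.
  by rewrite coprimeXl // prime_coprime // dvdn_prime2.
rewrite -(IH m mn m0) -(@sum_divisors_widen _ m n) ?m0 1?ltnW //.
apply: eq_bigl => d; case: (boolP (d %| m)%N) => [dm|]; last by rewrite andbF.
by rewrite nE dvdn_mulr.
Qed.

(** Möbius inversion of [sum_mangoldt] expresses [mangoldt n] as the sum of
    [moebius d * ln (n / d)]. The part with [ln n] vanishes by [sum_moebius], and for [n = 1]
    because [ln 1 = 0]. *)
Lemma sum_moebius_ln n : (0 < n)%N ->
  \sum_(1 <= d < n.+1 | (d %| n)%N) moebius d * ln d%:R = - mangoldt n.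
Proof.
move=> n0.
have -> : mangoldt n = \sum_(1 <= e < n.+1 | (e %| n)%N)
    mangoldt e * \sum_(1 <= d < n.+1 | (d %| n %/ e)%N) moebius d.
  rewrite big_mkcond (bigD1_seq n) ?iota_uniq ?mem_index_iota ?n0 ?ltnS //=.
  rewrite dvdnn divnn n0 sum_divisors_widen // sum_moebius // eqxx mulr1.
  rewrite big_seq_cond big1 ?addr0 // => e; rewrite mem_index_iota.
  move=> /andP[/andP[e0 en] ne]; case: ifP => // de.
  have ed0 : (0 < n %/ e)%N by rewrite divn_gt0.
  rewrite sum_divisors_widen ?ed0 ?leq_div // sum_moebius //.
  rewrite eq_sym eqn_div // mul1n (negbTE ne).
  by rewrite mulr0.
transitivity (- \sum_(1 <= d < n.+1 | (d %| n)%N) moebius d * ln (n %/ d)%N%:R).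
  have S0 : \sum_(1 <= d < n.+1 | (d %| n)%N) moebius d * ln n%:R = 0.
    rewrite -mulr_suml sum_moebius //; case: eqVneq => [->|_].
      by rewrite ln1 mulr0.
    by rewrite mul0r.
  rewrite -[RHS]add0r -[X in X + _]S0 -sumrB big_nat_cond [RHS]big_nat_cond.
  apply: eq_bigr => d /andP[/andP[d0 _] dn].
  have -> : ln (n%:R : R) = ln (n %/ d)%N%:R + ln d%:R.
    by rewrite -lnnM ?divnK // divn_gt0 // dvdn_leq.
  by ring.
congr (- _); under [RHS]eq_bigr do rewrite mulr_sumr.
rewrite (exchange_big_dep (fun d => d %| n)%N) /=; last first.
  by move=> e d en /dvdn_trans; apply; rewrite dvdn_div.
rewrite big_nat_cond [RHS]big_nat_cond.
apply: eq_bigr => d /andP[/andP[d0 _] dn].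
have nd0 : (0 < n %/ d)%N by rewrite divn_gt0 // dvdn_leq.
rewrite -(sum_mangoldt nd0) -(@sum_divisors_widen _ _ n) ?nd0 ?leq_div //.
rewrite mulr_sumr [LHS]big_nat_cond [RHS]big_nat_cond.
apply: eq_big => [e|e _]; last by rewrite mulrC.
apply: andb_id2l => /andP[e0 _].
apply/idP/andP => [ed|[en dE]].
  have en : (e %| n)%N by apply: dvdn_trans ed _; rewrite dvdn_div.
  by split=> //; rewrite dvdn_divRL // mulnC -dvdn_divRL.
by rewrite dvdn_divRL // mulnC -dvdn_divRL.
Qed.

(** After grouping the pairs by [n = d * m], the coefficient of [f n] is evaluated by [sum_moebius]
    and [sum_moebius_ln]. *)
Lemma tatuzawa_iseki f N : (0 < N)%N ->
  \sum_(1 <= d < N.+1) moebius d * (ln N%:R - ln d%:R)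
     * \sum_(1 <= m < (N %/ d).+1) f (d * m)%N
  = f 1%N * ln N%:R + \sum_(1 <= n < N.+1) mangoldt n * f n.
Proof.
move=> N0; under eq_bigr do rewrite mulr_sumr.
rewrite -(sum_divisors_exchange (fun d n => moebius d * (ln N%:R - ln d%:R) * f n)).
have E n : (1 <= n < N.+1)%N ->
    \sum_(1 <= d < N.+1 | (d %| n)%N) moebius d * (ln N%:R - ln d%:R) * f n
    = (n == 1%N)%:R * ln N%:R * f n + mangoldt n * f n.
  move=> /andP[n0 nN]; rewrite -mulr_suml sum_divisors_widen ?n0 //.
  under eq_bigr do rewrite mulrBr.
  rewrite sumrB -mulr_suml sum_moebius // sum_moebius_ln // opprK.
  by rewrite mulrDl.
rewrite big_nat (eq_bigr _ E) -big_nat big_split /=; congr (_ + _).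
rewrite big_ltn // eqxx mul1r mulrC big_nat big1 ?addr0 // => n /andP[n1 _].
by rewrite gtn_eqF // !mul0r.
Qed.

End DivisorSums.

(** * Chebyshev, Mertens and harmonic sums *)

Section Estimates.
Local Open Scope ring_scope.
Variable R : realType.
Implicit Types (d m n N p : nat) (x y z : R).
Local Notation mangoldt := (@mangoldt R).

Lemma ln_le_subr1 x : 0 < x -> ln x <= x - 1.
Proof. by move=> x0; rewrite -{1}(subrKC 1 x) le_ln1Dx //; lra. Qed.

Lemma ln_ge_1subrV x : 0 < x -> 1 - x^-1 <= ln x.
Proof.
move=> x0; have := @ln_le_subr1 x^-1; rewrite invr_gt0 lnV ?posrE // => /(_ x0).
lra.
Qed.

Lemma ler_lnW x y : 0 < x -> x <= y -> ln x <= ln y.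
Proof. by move=> x0 xy; rewrite ler_ln ?posrE //; apply: lt_le_trans xy. Qed.

Lemma ln_le_sqrt x : 0 < x -> ln x <= 2 * Num.sqrt x.
Proof.
move=> x0; rewrite -{1}(sqr_sqrtr (ltW x0)) lnXn ?sqrtr_gt0 //.
have := @ln_le_subr1 (Num.sqrt x); rewrite sqrtr_gt0 => /(_ x0).
by rewrite mulr2n; lra.
Qed.

(** The bound [1 - 1/x] at 2 gives only 1/2, too little for [dense_ln4]; on the factors 4/3 and 3/2
    it gives 1/4 + 1/3. *)
Lemma ln2_ge_7_12 : 7 / 12 <= ln (2 : R).
Proof.
have -> : (2 : R) = 4 / 3 * (3 / 2) by field.
rewrite lnM ?posrE; try lra.
have h1 := @ln_ge_1subrV (4 / 3); have h2 := @ln_ge_1subrV (3 / 2).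
have e1 : (4 / 3 : R)^-1 = 3 / 4 by field.
have e2 : (3 / 2 : R)^-1 = 2 / 3 by field.
rewrite e1 in h1; rewrite e2 in h2.
have := h1 ltac:(lra); have := h2 ltac:(lra); lra.
Qed.

Lemma lnS_sub_le n : (0 < n)%N -> ln (n.+1%:R : R) - ln n%:R <= n%:R^-1.
Proof.
move=> n0; have n0' : 0 < (n%:R : R) by rewrite ltr0n.
rewrite -ln_div ?posrE ?ltr0n // -natr1 mulrDl mul1r divff ?gt_eqF //.
have := @le_ln1Dx R n%:R^-1; apply.
by apply: lt_trans (_ : 0 < _); rewrite ?invr_gt0 //; lra.
Qed.

Lemma lnS_sub_ge n : (0 < n)%N -> n.+1%:R^-1 <= ln (n.+1%:R : R) - ln n%:R.
Proof.
move=> n0; have n0' : 0 < (n%:R : R) by rewrite ltr0n.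
rewrite -ln_div ?posrE ?ltr0n //.
apply: le_trans (ln_ge_1subrV _); last by rewrite divr_gt0 // ltr0n.
rewrite invf_div -natr1 le_eqVlt; apply/orP; left; apply/eqP; field.
by rewrite natr1 pnatr_eq0.
Qed.

Lemma ln_fact N : ln (N`!%:R : R) = \sum_(1 <= n < N.+1) ln n%:R.
Proof.
elim: N => [|N IH]; first by rewrite big_geq // ln1.
by rewrite factS lnnM ?fact_gt0 // IH [RHS]big_nat_recr //= addrC.
Qed.

Lemma ln_fact_ge N : N%:R * ln N%:R - N%:R <= ln (N`!%:R : R).
Proof.
elim: N => [|N IH]; first by rewrite mul0r subr0 ln1.
rewrite factS lnnM ?fact_gt0 //; case: N IH => [|N] IH; first by rewrite ln1; lra.
have := @lnS_sub_le N.+1 isT.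
have N0 : 0 < (N.+1%:R : R) by rewrite ltr0n.
move=> /(ler_wpM2l (ltW N0)); rewrite mulfV ?gt_eqF // mulrBr.
rewrite -[N.+2%:R]natr1; lra.
Qed.

Lemma ln_fact_le N : (0 < N)%N ->
  ln (N`!%:R : R) <= N%:R * ln N%:R - N%:R + ln N%:R + 1.
Proof.
elim: N => [//|N IH] _; rewrite factS lnnM ?fact_gt0 //.
case: N IH => [|N] IH; first by rewrite ln1; lra.
have {}IH := IH isT; have := @lnS_sub_ge N.+1 isT.
have N0 : 0 < (N.+2%:R : R) by rewrite ltr0n.
move=> /(ler_wpM2l (ltW N0)); rewrite mulfV ?gt_eqF // mulrBr.
move: IH; move: (ln N.+2%:R) (ln N.+1%:R) => a b.
rewrite -[N.+2%:R]natr1; lra.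
Qed.

Definition psin N : R := \sum_(1 <= n < N.+1) mangoldt n.

Lemma psin_ge0 N : 0 <= psin N.
Proof. by apply: sumr_ge0 => n _; apply: mangoldt_ge0. Qed.

(** Legendre's formula. Terms with [d > N] vanish, so the free limit [K] allows several factorials
    to be compared term by term. *)
Lemma ln_fact_mangoldt N K : (N <= K)%N ->
  ln (N`!%:R : R) = \sum_(1 <= d < K.+1) mangoldt d * (N %/ d)%N%:R.
Proof.
move=> NK; rewrite ln_fact.
transitivity (\sum_(1 <= n < N.+1) \sum_(1 <= d < N.+1 | (d %| n)%N) mangoldt d).
  rewrite big_nat [RHS]big_nat; apply: eq_bigr => n /andP[n0 nN].
  by rewrite sum_divisors_widen ?n0 // sum_mangoldt.
rewrite (sum_divisors_exchange (fun d _ => mangoldt d)).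
rewrite [RHS](@big_cat_nat _ _ _ N.+1) //= [X in _ = _ + X]big_nat [X in _ = _ + X]big1 ?addr0.
  by apply: eq_bigr => d _; rewrite sumr_const_nat subSS subn0 mulr_natr.
by move=> d /andP[Nd _]; rewrite divn_small // mulr0.
Qed.

Lemma sum_div_cond (g : nat -> R) d N : (0 < d)%N ->
  \sum_(1 <= m < (N %/ d).+1) g m = \sum_(1 <= m < N.+1 | (d * m <= N)%N) g m.
Proof.
move=> d0; rewrite (big_nat_widen _ _ N.+1) ?ltnS ?leq_div //.
by apply: eq_bigl => m; rewrite ltnS leq_divRL // mulnC.
Qed.

Lemma ln_fact_psin N : ln (N`!%:R : R) = \sum_(1 <= m < N.+1) psin (N %/ m).
Proof.
rewrite (ln_fact_mangoldt (leqnn N)).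
transitivity (\sum_(1 <= d < N.+1) \sum_(1 <= m < N.+1 | (d * m <= N)%N) mangoldt d).
  rewrite big_nat [RHS]big_nat; apply: eq_bigr => d /andP[d0 _].
  by rewrite -sum_div_cond // sumr_const_nat subSS subn0 mulr_natr.
rewrite (exchange_big_dep predT) //= big_nat [RHS]big_nat.
apply: eq_bigr => m /andP[m0 _]; rewrite /psin sum_div_cond //.
by apply: eq_bigl => d; rewrite mulnC.
Qed.

(** In the middle term the coefficient of [mangoldt d] is [N %/ d - 2 * (h %/ d)], the parity of
    [N %/ d]; it equals 1 for [h < d <= N]. *)
Lemma psin_chebyshev_step N (h := (N %/ 2)%N) :
  psin N - psin h <= ln (N`!%:R : R) - 2 * ln h`!%:R <= psin N.
Proof.
have hN : (h <= N)%N by rewrite leq_div.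
rewrite !(@ln_fact_mangoldt _ N) // mulr_sumr -sumrB.
have E d : (0 < d)%N -> (N %/ d = 2 * (h %/ d) + (N %/ d) %% 2)%N.
  move=> d0; rewrite {1}(divn_eq (N %/ d) 2); congr (_ + _)%N.
  by rewrite mulnC /h -!divnMA [(d * 2)%N]mulnC.
apply/andP; split.
  rewrite /psin [X in X - _](@big_cat_nat _ _ _ h.+1) //= addrAC subrr add0r.
  rewrite [X in _ <= X](@big_cat_nat _ _ _ h.+1) //= -[X in X <= _]add0r.
  apply: lerD.
    rewrite big_nat; apply: sumr_ge0 => d /andP[d0 _].
    rewrite {1}(E d d0) natrD natrM mulrDr.
    rewrite [X in _ <= X](_ : _ = mangoldt d * (N %/ d %% 2)%N%:R); last by ring.
    by rewrite mulr_ge0 ?mangoldt_ge0.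
  rewrite big_nat [X in _ <= X]big_nat; apply: ler_sum => d /andP[hd dN].
  rewrite (divn_small hd) !mulr0 subr0 ler_peMr ?mangoldt_ge0 //.
  by rewrite ler1n divn_gt0 //; apply: leq_trans hd.
rewrite /psin big_nat [X in _ <= X]big_nat; apply: ler_sum => d /andP[d0 dN].
rewrite {1}(E d d0) natrD natrM mulrDr.
rewrite [X in X <= _](_ : _ = mangoldt d * (N %/ d %% 2)%N%:R); last by ring.
rewrite ler_piMr ?mangoldt_ge0 // lern1.
by rewrite -ltnS ltn_mod.
Qed.

Lemma psin_le_linear N : psin N <= 8 * N%:R.
Proof.
elim/ltn_ind: N => N IH; have [N1|N1] := leqP N 1.
  suff -> : psin N = 0 by rewrite mulr_ge0.
  rewrite /psin; case: N N1 {IH} => [|[|]] // _; first by rewrite big_geq.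
  by rewrite big_nat1.
set h := (N %/ 2)%N; have /andP[+ _] := psin_chebyshev_step N; rewrite -/h.
have h0 : (0 < h)%N by rewrite divn_gt0.
have := IH h; rewrite ltn_Pdiv ?(ltnW N1) // => /(_ isT).
have := @ln_fact_le N (ltnW N1); have := ln_fact_ge h.
have hN : (2 * h <= N <= 2 * h + 1)%N by rewrite /h; lia.
have lh : ln (h%:R : R) <= h%:R - 1 by rewrite ln_le_subr1 // ltr0n.
have lN : ln (N%:R : R) <= ln h%:R + 2.
  apply: le_trans (@ler_lnn R N (3 * h) _) _; first by lia.
  rewrite lnnM // addrC lerD2l; apply: le_trans (ln_le_subr1 _) _; lra.
have lh0 : 0 <= ln (h%:R : R) by exact: lnn_ge0.
have := ler_wpM2l (ler0n R N) lN.
move: lh lN lh0; move: (ln N%:R) (ln h%:R) => a b.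
have : 2 * h%:R <= (N%:R : R) <= 2 * h%:R + 1.
  by rewrite -(natrM R 2) natr1 !ler_nat; move: hN; rewrite addn1.
move: (ln _) (ln _) (psin N) (psin h) (N%:R : R) (h%:R : R) => c e f g n k.
move=> /andP[h1 h2] *.
have : (n - 2 * k) * b <= b by rewrite ler_piMl //; lra.
lra.
Qed.

Lemma psin_ge_linear N : (1 < N)%N ->
  N%:R * ln 2 - 2 * ln N%:R - 2 <= psin N.
Proof.
move=> N1; set h := (N %/ 2)%N.
have /andP[_] := psin_chebyshev_step N; rewrite -/h.
have h0 : (0 < h)%N by rewrite divn_gt0.
have := @ln_fact_le h h0; have := ln_fact_ge N.
have hN : (2 * h <= N)%N by rewrite /h; lia.
have N0 : 0 < (N%:R : R) by rewrite ltr0n ltnW.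
have h0' : 0 < (h%:R : R) by rewrite ltr0n.
have lE : ln (2 * h%:R : R) = ln 2 + ln h%:R by rewrite lnM ?posrE.
have lh : ln (h%:R : R) <= ln N%:R - ln 2.
  have := @ler_lnn R (2 * h)%N N hN; rewrite (natrM R 2) lE; lra.
have l1 : 2 * h%:R * (ln h%:R - 1) <= N%:R * (ln N%:R - ln 2 - 1) :> R.
  have hN' : 2 * h%:R <= (N%:R : R) by rewrite -(natrM R 2) ler_nat.
  (* [u (ln (u / 2) - 1)] is nondecreasing for [u >= 2] *)
  have : N%:R - 2 * h%:R <= N%:R * (ln N%:R - ln (2 * h%:R)) :> R.
    have u0 : 0 < (2 * h%:R : R) by rewrite mulr_gt0.
    rewrite -ln_div ?posrE //; have := @ln_ge_1subrV (N%:R / (2 * h%:R)).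
    rewrite divr_gt0 // => /(_ isT) /(ler_wpM2l (ltW N0)).
    by rewrite mulrBr mulr1 invf_div [X in _ - X <= _]mulrC divfK ?gt_eqF.
  rewrite lE; have : 0 <= (N%:R - 2 * h%:R) * ln h%:R :> R.
    by rewrite mulr_ge0 ?lnn_ge0 ?subr_ge0.
  lra.
have := ler_lnn R (leq_div N 2); rewrite -/h.
lra.
Qed.

(** Replacing each [N %/ d] by [N / d] in the formula for [ln N!] costs at most
    [psin N <= 8 * N]. *)
Lemma mertens N : (0 < N)%N ->
  ln N%:R - 1 <= \sum_(1 <= n < N.+1) mangoldt n / n%:R <= ln N%:R + 9.
Proof.
move=> N0; have N0' : 0 < (N%:R : R) by rewrite ltr0n.
set S := \sum_(_ <= _ < _) _.
have S1 : ln (N`!%:R : R) <= N%:R * S.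
  rewrite (ln_fact_mangoldt (leqnn N)) mulr_sumr big_nat [X in _ <= X]big_nat.
  apply: ler_sum => d /andP[d0 _]; rewrite mulrCA ler_wpM2l ?mangoldt_ge0 //.
  by rewrite ler_pdivlMr ?ltr0n // -natrM ler_nat leq_divM.
have S2 : N%:R * S <= ln (N`!%:R : R) + psin N.
  rewrite (ln_fact_mangoldt (leqnn N)) mulr_sumr -big_split /=.
  rewrite big_nat [X in _ <= X]big_nat.
  apply: ler_sum => d /andP[d0 _].
  rewrite -[X in _ + X]mulr1 -mulrDr mulrCA ler_wpM2l ?mangoldt_ge0 //.
  by rewrite ler_pdivrMr ?ltr0n // natr1 -natrM ler_nat ltnW // ltn_ceil.
have := psin_le_linear N; have := ln_fact_ge N; have := ln_fact_le N0.
have := @ln_le_subr1 N%:R N0' => *.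
apply/andP; split; rewrite -(ler_pM2l N0'); lra.
Qed.

Definition harmonic_sum N : R := \sum_(1 <= n < N.+1) n%:R^-1.

(* [g] is Euler's constant. *)
Lemma harmonic_ln : exists2 g : R, 0 <= g <= 1 &
  forall N, (0 < N)%N -> ln N%:R + g <= harmonic_sum N <= ln N%:R + g + N%:R^-1.
Proof.
(* [u] decreases, [v] increases and [v <= u] throughout, so the supremum of [v] separates them. *)
pose u N := harmonic_sum N - ln N%:R; pose v N := u N - N%:R^-1.
have HS N : harmonic_sum N.+1 = harmonic_sum N + N.+1%:R^-1.
  by rewrite /harmonic_sum big_nat_recr.
have uS N : (0 < N)%N -> u N.+1 <= u N.
  move=> /lnS_sub_ge; rewrite /u HS.
  by move: (N.+1%:R^-1) (ln _) (ln _) => a b c; lra.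
have vS N : (0 < N)%N -> v N <= v N.+1.
  move=> /lnS_sub_le; rewrite /v /u HS.
  by move: (N%:R^-1) (N.+1%:R^-1) (ln _) (ln _) => a a' b c; lra.
have u_le M N : (0 < M)%N -> (M <= N)%N -> u N <= u M.
  move=> M0 /subnK <-; elim: (N - M)%N => [//|k IH].
  by rewrite addSn; apply: le_trans (uS _ _) IH; rewrite addn_gt0 M0 orbT.
have v_le M N : (0 < M)%N -> (M <= N)%N -> v M <= v N.
  move=> M0 /subnK <-; elim: (N - M)%N => [//|k IH].
  by rewrite addSn; apply: le_trans IH (vS _ _); rewrite addn_gt0 M0 orbT.
have vu M N : (0 < M)%N -> (0 < N)%N -> v M <= u N.
  move=> M0 N0; apply: le_trans (v_le _ (maxn M N) _ _) _; rewrite ?leq_maxl //.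
  apply: le_trans (u_le _ (maxn M N) N0 _); rewrite ?leq_maxr //.
  by rewrite /v gerBl invr_ge0.
pose E := [set x | exists2 N, (0 < N)%N & x = v N]%classic.
have E0 : (E !=set0)%classic by exists (v 1%N), 1%N.
have Eub N : (0 < N)%N -> (ubound E (u N))%classic.
  by move=> N0 _ [M M0 ->]; apply: vu.
have supE : has_sup E by split=> //; exists (u 1%N); apply: Eub.
have H1 : harmonic_sum 1 = 1 by rewrite /harmonic_sum big_nat1 invr1.
exists (sup E) => [|N N0].
  apply/andP; split.
    apply: (le_trans _ (sup_upper_bound supE _)); last by exists 1%N.
    by rewrite /v /u H1 ln1 invr1; lra.
  apply: le_trans (ge_sup E0 (Eub 1%N isT)) _.
  by rewrite /u H1 ln1; lra.
have := ge_sup E0 (Eub N N0).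
have : v N <= sup E by apply: sup_upper_bound => //; exists N.
rewrite /v /u; move: (N%:R^-1) (ln _) => a b *.
by apply/andP; split; lra.
Qed.

Lemma sum_invr_sqrt N :
  \sum_(1 <= n < N.+1) (Num.sqrt n%:R)^-1 <= 2 * Num.sqrt N%:R :> R.
Proof.
elim: N => [|N IH]; first by rewrite big_geq // sqrtr0 mulr0.
rewrite big_nat_recr //=; apply: le_trans (lerD IH (lexx _)) _.
have a0 : 0 <= Num.sqrt (N%:R : R) by exact: sqrtr_ge0.
have b0 : 0 < Num.sqrt (N.+1%:R : R) by rewrite sqrtr_gt0 ltr0n.
have ab : Num.sqrt (N.+1%:R : R) ^+ 2 = Num.sqrt (N%:R : R) ^+ 2 + 1.
  by rewrite !sqr_sqrtr // natr1.
move: (Num.sqrt _) (Num.sqrt _) a0 b0 ab => a b a0 b0 ab.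
rewrite -(ler_pM2r b0) mulrDl mulVf ?gt_eqF //.
have := sqr_ge0 (b - a); move: ab; rewrite !expr2 => *; lra.
Qed.

End Estimates.

(** * Selberg's formula *)

Section Selberg.
Local Open Scope ring_scope.
Variable R : realType.
Implicit Types (d m n N p : nat) (x y z : R).
Local Notation mangoldt := (@mangoldt R).
Local Notation psin := (@psin R).

(** A square root bound makes the remainders at [z = N / d] sum to [O(N)]. Here 22 = 16 + 6, from
    [ln z <= 4 z^(1/4)] and [ln z <= 2 z^(1/2)]. *)
Lemma ln_mul_ln_le z : 1 <= z -> ln z * (ln z + 3) <= 22 * Num.sqrt z.
Proof.
move=> z1; have z0 : 0 < z by lra.
have s1 : 1 <= Num.sqrt z by rewrite -sqrtr1 ler_wsqrtr.
have l1 := ln_le_sqrt z0.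
have l2 : ln z <= 4 * Num.sqrt (Num.sqrt z).
  rewrite -{1}(sqr_sqrtr (ltW z0)) lnXn ?sqrtr_gt0 //.
  have := @ln_le_sqrt R (Num.sqrt z); rewrite sqrtr_gt0 => /(_ z0).
  by rewrite mulr2n; lra.
have l0 : 0 <= ln z by rewrite ln_ge0.
have : ln z * ln z <= 4 * Num.sqrt (Num.sqrt z) * (4 * Num.sqrt (Num.sqrt z)).
  by apply: ler_pM.
have := sqr_sqrtr (sqrtr_ge0 z); rewrite expr2; lra.
Qed.

(** The [psin] terms sum to [ln Y!], about [Y ln Y - Y], and the terms [y / m] to about
    [Y (ln Y + g)]. The constant [g + 1] cancels the linear part, leaving a logarithmic error. *)
Lemma selberg_remainder (g : R) N d : 0 <= g <= 1 ->
    (forall M, (0 < M)%N ->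
       ln M%:R + g <= harmonic_sum R M <= ln M%:R + g + M%:R^-1) ->
    (0 < d <= N)%N ->
  `|\sum_(1 <= m < (N %/ d).+1)
       (psin (N %/ (d * m)) - N%:R / (d * m)%N%:R + (g + 1))|
  <= ln (N%:R / d%:R) + 3.
Proof.
move=> /andP[g0 g1] Hg /andP[d0 dN].
set Y := (N %/ d)%N; set y := N%:R / d%:R : R.
have Y0 : (0 < Y)%N by rewrite divn_gt0.
have d0' : 0 < (d%:R : R) by rewrite ltr0n.
have Y0' : 1 <= (Y%:R : R) by rewrite ler1n.
have Yy : Y%:R <= y by rewrite ler_pdivlMr // -natrM ler_nat leq_divM.
have yY : y <= Y%:R + 1.
  by rewrite ler_pdivrMr // natr1 -natrM ler_nat ltnW // ltn_ceil.
rewrite big_split /= sumrB.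
rewrite [X in X - _](_ : _ = ln Y`!%:R); last first.
  by rewrite ln_fact_psin; apply: eq_bigr => m _; rewrite divnMA.
rewrite [X in _ - X](_ : _ = y * harmonic_sum R Y); last first.
  rewrite mulr_sumr; apply: eq_bigr => m _.
  by rewrite natrM invfM mulrA.
rewrite sumr_const_nat subSS subn0 -[_ *+ Y]mulr_natr.
have lY : ln (Y%:R : R) <= ln y by apply: ler_lnW => //; lra.
have lY0 : 0 <= ln (Y%:R : R) by exact: lnn_ge0.
have t1 := ln_fact_ge R Y; have t2 := @ln_fact_le R Y Y0.
have /andP[h1 h2] := Hg Y Y0.
have y0 : 0 <= y by lra.
have h1' := ler_wpM2l y0 h1; have := ler_wpM2l y0 h2.
have : y * Y%:R^-1 <= 2.
  by rewrite ler_pdivrMr; lra.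
move: h1' t1 t2 lY lY0; rewrite !mulrDr.
move: (ln _) (ln y) (ln _) (harmonic_sum R Y) => a b c h.
move: (y * _^-1) => e h1' t1 t2 lY lY0 he h2'.
have p1 : 0 <= (y - Y%:R) * c by rewrite mulr_ge0 // subr_ge0.
have p2 : (y - Y%:R) * c <= c by rewrite ler_piMl //; lra.
have p3 : 0 <= (y - Y%:R) * g by rewrite mulr_ge0 // subr_ge0.
have p4 : (y - Y%:R) * g <= g by rewrite ler_piMl //; lra.
rewrite ler_norml; apply/andP; split; lra.
Qed.

(** [tatuzawa_iseki] is applied to the error term [f]. The left side is at most the sum of
    [22 sqrt (N / d)], hence [44 N]. On the right [- N ln N] occurs twice, once in [f 1 * ln N] and
    once through [mertens]. *)
Lemma selberg_nat N : (0 < N)%N ->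
  `|psin N * ln N%:R + \sum_(1 <= n < N.+1) mangoldt n * psin (N %/ n)
    - 2 * N%:R * ln N%:R| <= 71 * N%:R.
Proof.
move=> N0; have N0' : 0 < (N%:R : R) by rewrite ltr0n.
have [g g01 Hg] := harmonic_ln R.
pose f n := psin (N %/ n) - N%:R / n%:R + (g + 1).
have := tatuzawa_iseki f N0; set S := \sum_(_ <= _ < _) _.
have SB : `|S| <= 44 * N%:R.
  apply: (le_trans (ler_norm_sum _ _ _)).
  apply: (@le_trans _ _ (\sum_(1 <= d < N.+1)
      22 * Num.sqrt N%:R * (Num.sqrt d%:R)^-1)).
    rewrite big_nat [X in _ <= X]big_nat; apply: ler_sum => d /andP[d0 dN].
    have d0' : 0 < (d%:R : R) by rewrite ltr0n.
    have := @ln_mul_ln_le (N%:R / d%:R).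
    rewrite ler_pdivlMr // mul1r ler_nat => /(_ dN).
    have := sqrtrM d%:R^-1 (ltW N0'); rewrite (sqrtrV (ltW d0')) => -> h.
    apply: le_trans (le_trans _ h) _; last by rewrite mulrA.
    have l0 : 0 <= ln (N%:R / d%:R : R).
      by rewrite ln_ge0 // ler_pdivlMr // mul1r ler_nat.
    rewrite !normrM -ln_div ?posrE // (ger0_norm l0).
    apply: ler_pM => //; first by rewrite mulr_ge0.
      by rewrite ler_piMl // normr_moebius.
    by apply: selberg_remainder; rewrite ?d0.
  rewrite -mulr_sumr.
  have s0 : 0 <= 22 * Num.sqrt (N%:R : R) by rewrite mulr_ge0 ?sqrtr_ge0.
  apply: le_trans (ler_wpM2l s0 (sum_invr_sqrt R N)) _.
  have := sqr_sqrtr (ltW N0'); rewrite expr2; lra.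
rewrite {1}/f divn1 divr1.
have -> : \sum_(1 <= n < N.+1) mangoldt n * f n
    = \sum_(1 <= n < N.+1) mangoldt n * psin (N %/ n)
      - N%:R * \sum_(1 <= n < N.+1) mangoldt n / n%:R + (g + 1) * psin N.
  rewrite !mulr_sumr -sumrB -big_split /=; apply: eq_bigr => n _.
  by rewrite /f; ring.
have /andP[m1 m2] := mertens R N0.
move: (ler_wpM2l (ltW N0') m1) (ler_wpM2l (ltW N0') m2) => {m1 m2}.
have := psin_le_linear R N; have := psin_ge0 R N.
have := lnn_ge0 R N; have := ln_le_subr1 N0'.
move: S SB g01 => S SB g01 {Hg f}; move: SB g01; move: (\sum_(_ <= _ < _) _) (\sum_(_ <= _ < _) _) => A B.
move: (ln _) (psin N) => l q; rewrite !ler_norml => /andP[s1 s2] /andP[g0 g1].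
move=> l1 l0 q0 q1 m1 m2 E.
have : 0 <= g * q by rewrite mulr_ge0.
have : 0 <= g * l by rewrite mulr_ge0.
have : g * q <= q by rewrite ler_piMl.
have : g * l <= l by rewrite ler_piMl.
move=> *; apply/andP; split; lra.
Qed.

Definition cumul (w : nat -> R) x : R := \sum_(1 <= n < (Num.truncn x).+1) w n.

Definition psi x : R := cumul mangoldt x.

Lemma psiE x : psi x = psin (Num.truncn x).
Proof. by []. Qed.

Lemma trunc_divn x n : 0 <= x -> (0 < n)%N ->
  Num.truncn (x / n%:R) = (Num.truncn x %/ n)%N.
Proof.
move=> x0 n0; have n0' : 0 < (n%:R : R) by rewrite ltr0n.
apply: truncn_def; apply/andP; split.
  rewrite ler_pdivlMr // -natrM -truncn_ge_nat // leq_divM //.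
rewrite ltr_pdivrMr // -natrM -truncn_lt_nat // ltn_ceil //.
Qed.

Lemma selberg x : 1 <= x ->
  `|psi x * ln x + \sum_(1 <= n < (Num.truncn x).+1) mangoldt n * psi (x / n%:R)
    - 2 * x * ln x| <= 90 * x.
Proof.
move=> x1; have x0 : 0 <= x by lra.
set N := Num.truncn x; have N0 : (0 < N)%N by rewrite truncn_gt0.
have N1' : 1 <= (N%:R : R) by rewrite ler1n.
have /andP[Nx xN] := truncn_itv x0; rewrite -/N -natr1 in Nx xN.
have := selberg_nat N0.
have -> : \sum_(1 <= n < N.+1) mangoldt n * psi (x / n%:R)
        = \sum_(1 <= n < N.+1) mangoldt n * psin (N %/ n).
  rewrite big_nat [RHS]big_nat; apply: eq_bigr => n /andP[n0 _].
  by rewrite psiE trunc_divn.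
rewrite psiE -/N.
have l1 : ln N%:R <= ln x by apply: ler_lnW; lra.
(* This keeps the cost of replacing [N] by [x] inside the logarithms bounded. *)
have l2 : N%:R * (ln x - ln N%:R) <= 1.
  rewrite -ln_div ?posrE; try lra.
  have := @ln_le_subr1 R (x / N%:R).
  rewrite divr_gt0; try lra.
  move=> /(_ isT); rewrite -(ler_pM2l (_ : 0 < N%:R)); last lra.
  rewrite mulrBr mulr1 [X in _ <= X - _]mulrC divfK; last by rewrite gt_eqF //; lra.
  lra.
have := psin_le_linear R N; have := psin_ge0 R N.
have l3 : ln x <= x - 1 by apply: ln_le_subr1; lra.
have l0 : 0 <= ln (N%:R : R) by exact: lnn_ge0.
move: l1 l2 l3 l0 (\sum_(_ <= _ < _) _) (psin N) => + + + + A q.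
move: (ln x) (ln (N%:R : R)) => b a.
move: (N%:R : R) Nx xN N1' => n Nx xN N1' l1 l2 l3 l0 q0 q1.
rewrite !ler_norml => /andP[s1 s2].
have : 0 <= q * (b - a) by rewrite mulr_ge0 // subr_ge0.
have : q * (b - a) <= 8 * n * (b - a) by rewrite ler_wpM2r // subr_ge0.
have : 0 <= (x - n) * b by apply: mulr_ge0; lra.
have : (x - n) * b <= b by apply: ler_piMl; lra.
have : 0 <= n * (b - a) by apply: mulr_ge0; lra.
move=> *; apply/andP; split; lra.
Qed.

End Selberg.

(** * Mass of short intervals *)

Section Gaps.
Local Open Scope ring_scope.
Variable R : realType.
Implicit Types (d m n N p : nat) (a b x y z : R).
Local Notation mangoldt := (@mangoldt R).

Lemma cumulB (w : nat -> R) a b : a <= b ->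
  cumul w b - cumul w a = \sum_((Num.truncn a).+1 <= n < (Num.truncn b).+1) w n.
Proof.
move=> ab; rewrite /cumul (@big_cat_nat _ _ _ (Num.truncn a).+1) //=.
  by rewrite addrAC subrr add0r.
by rewrite ltnS le_truncn.
Qed.

Lemma mem_trunc_itv (a b : R) n : 0 <= a -> a <= b ->
  ((Num.truncn a).+1 <= n < (Num.truncn b).+1)%N = (a < n%:R <= b).
Proof.
move=> a0 ab; rewrite ltnS; have b0 := le_trans a0 ab.
by rewrite truncn_ge_nat // truncn_lt_nat.
Qed.

Lemma ler_cumul (w : nat -> R) a b : (forall n, 0 <= w n) -> a <= b ->
  cumul w a <= cumul w b.
Proof. by move=> w0 ab; rewrite -subr_ge0 cumulB // sumr_ge0. Qed.

Lemma cumul_ge0 (w : nat -> R) a : (forall n, 0 <= w n) -> 0 <= cumul w a.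
Proof. by move=> w0; rewrite sumr_ge0. Qed.

Lemma cumul_diff_eq (w w' : nat -> R) a b : 0 <= a -> a <= b ->
  (forall n, a < n%:R <= b -> w n = w' n) ->
  cumul w b - cumul w a = cumul w' b - cumul w' a.
Proof.
move=> a0 ab E; rewrite !cumulB // big_nat [RHS]big_nat.
by apply: eq_bigr => n; rewrite mem_trunc_itv // => /E.
Qed.

Local Notation wt := (fun n => mangoldt n / n%:R).
Definition mert x : R := cumul wt x.

Lemma wt_ge0 n : 0 <= wt n.
Proof. by rewrite divr_ge0 ?mangoldt_ge0. Qed.

Lemma ler_mert a b : a <= b -> mert a <= mert b.
Proof. exact/ler_cumul/wt_ge0. Qed.

Lemma mert_ge0 a : 0 <= mert a.
Proof. exact/cumul_ge0/wt_ge0. Qed.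

Lemma ler_psi a b : a <= b -> psi a <= psi b.
Proof. exact/ler_cumul/mangoldt_ge0. Qed.

Lemma psi_ge0 a : 0 <= psi a.
Proof. exact/cumul_ge0/mangoldt_ge0. Qed.

Lemma psi_le x : 0 <= x -> psi x <= 8 * x.
Proof.
move=> x0; rewrite psiE; apply: le_trans (psin_le_linear R _) _.
by rewrite ler_pM2l // truncn_le.
Qed.

Lemma mert_bounds x : 1 <= x -> ln x - 2 <= mert x <= ln x + 9.
Proof.
move=> x1; have x0 : 0 <= x by lra.
set N := Num.truncn x; have N0 : (0 < N)%N by rewrite truncn_gt0.
have N1' : 1 <= (N%:R : R) by rewrite ler1n.
have /andP[Nx xN] := truncn_itv x0; rewrite -/N -natr1 in Nx xN.
have /andP[m1 m2] := mertens R N0.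
have l1 : ln (N%:R : R) <= ln x by apply: ler_lnW; lra.
have l2 : ln x <= ln (2 * N%:R : R) by apply: ler_lnW; lra.
have l3 : ln (2 : R) <= 1 by apply: le_trans (ln_le_subr1 _) _; lra.
rewrite lnM ?posrE in l2; try lra.
rewrite /mert /cumul -/N; apply/andP; split; lra.
Qed.

Lemma psi_mert a b : 0 < a -> a <= b -> (psi b - psi a) / b <= mert b - mert a.
Proof.
move=> a0 ab; have b0 := lt_le_trans a0 ab.
rewrite !cumulB // mulr_suml big_nat [X in _ <= X]big_nat.
apply: ler_sum => n; rewrite (mem_trunc_itv _ (ltW a0) ab) => /andP[an nb].
rewrite ler_wpM2l ?mangoldt_ge0 // lef_pV2 ?posrE //.
exact: lt_trans an.
Qed.

Lemma brun_titchmarsh (eta : R) : 0 < eta -> exists2 Y : R, 1 <= Y &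
  forall a b, Y <= a -> a <= b -> psi b - psi a <= 2 * (b - a) + eta * b.
Proof.
move=> eta0; have e0 : 0 <= 182 / eta by rewrite divr_ge0 // ltW.
exists (expR (182 / eta)) => [|a b Ya ab]; first by have := expR_ge1Dx (182 / eta); lra.
have a1 : 1 <= a by have := expR_ge1Dx (182 / eta); lra.
have b1 : 1 <= b by lra.
have lb : 182 <= eta * ln b.
  have : 182 / eta <= ln b.
    by rewrite -[X in X <= _]expRK; apply: ler_lnW; rewrite ?expR_gt0 //; lra.
  by rewrite ler_pdivrMr // mulrC.
have := selberg a1; have := selberg b1.
have S1 : \sum_(1 <= n < (Num.truncn a).+1) mangoldt n * psi (a / n%:R)
       <= \sum_(1 <= n < (Num.truncn b).+1) mangoldt n * psi (b / n%:R).
  rewrite [X in _ <= X](@big_cat_nat _ _ _ (Num.truncn a).+1) ?ltnS ?le_truncn //=.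
  rewrite -[X in X <= _]addr0; apply: lerD.
    apply: ler_sum => n _; rewrite ler_wpM2l ?mangoldt_ge0 // ler_psi //.
    by rewrite ler_wpM2r ?invr_ge0.
  by apply: sumr_ge0 => n _; rewrite mulr_ge0 ?mangoldt_ge0 ?psi_ge0.
move: S1; move: (\sum_(_ <= _ < _) _) (\sum_(_ <= _ < _) _) => A B AB.
rewrite !ler_norml => /andP[_ sb] /andP[sa _].
have lab : ln a <= ln b by apply: ler_lnW; lra.
have lab' : a * (ln b - ln a) <= b - a.
  rewrite -ln_div ?posrE; try lra.
  have := @ln_le_subr1 R (b / a); rewrite divr_gt0; try lra.
  move=> /(_ isT); rewrite -(ler_pM2l (_ : 0 < a)); last lra.
  by rewrite mulrBr mulr1 [X in _ <= X - _]mulrC divfK // gt_eqF //; lra.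
have lb0 : 0 < ln b.
  by rewrite -(pmulr_rgt0 _ eta0); lra.
have p0 := psi_ge0 a.
have pab : 0 <= psi a * (ln b - ln a) by rewrite mulr_ge0 // subr_ge0.
have eb : 182 * b <= eta * ln b * b by rewrite ler_wpM2r //; lra.
rewrite -(ler_pM2r lb0); lra.
Qed.

(* If [x, rho x] is almost free of primes, Selberg's formula forces
   [x/n, rho x/n] to carry twice the average mass for most [n]. *)
Lemma bad_weight (rho eta sig Y x : R) :
    1 < rho <= 4 -> 0 < eta <= 1 -> 0 < sig -> 1 <= Y -> Y <= x ->
    (forall a b, Y <= a -> a <= b -> psi b - psi a <= 2 * (b - a) + eta * b) ->
    psi (rho * x) - psi x <= eta * x ->
  sig * cumul (fun n => if psi (rho * (x / n%:R)) - psi (x / n%:R)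
                           < (2 * (rho - 1) - sig) * (x / n%:R)
                        then mangoldt n / n%:R else 0) (x / Y)
  <= 5 * eta * ln x + (32 * ln Y + 1015).
Proof.
move=> /andP[rho1 rho4] /andP[eta0 eta1] sig0 Y1 Yx BT gap.
have x1 : 1 <= x by lra.
set z := rho * x; have xz : x <= z by rewrite ler_peMl; lra.
have z4 : z <= 4 * x by rewrite ler_wpM2r; lra.
set q := x / Y; have Y0 : 0 < Y by lra.
have q1 : 1 <= q by rewrite ler_pdivlMr // mul1r.
have qx : q <= x by rewrite ler_pdivrMr // ler_peMr; lra.
set W := cumul _ q.
have lz : ln z = ln rho + ln x by rewrite lnM ?posrE; lra.
have lq : ln q = ln x - ln Y by rewrite ln_div ?posrE; lra.
have lrho : ln rho <= 3 by apply: le_trans (ln_le_subr1 _) _; lra.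
have lrho0 : 0 <= ln rho by rewrite ln_ge0; lra.
have lY0 : 0 <= ln Y by rewrite ln_ge0.
have lx0 : 0 <= ln x by rewrite ln_ge0.
have /andP[mz1 mz2] : ln z - 2 <= mert z <= ln z + 9 by apply: mert_bounds; lra.
have /andP[mq1 mq2] := mert_bounds q1.
have := selberg x1; have := @selberg R z ltac:(lra).
pose D n := psi (rho * (x / n%:R)) - psi (x / n%:R).
have zn n : z / n%:R = rho * (x / n%:R) by rewrite mulrA.
(* For [n > q] the point [x / n] is below [Y], out of reach of [BT]; there Chebyshev's bound and
   Mertens give only [O(x (ln Y + 1))]. *)
have S1 : \sum_(1 <= n < (Num.truncn z).+1) mangoldt n * psi (z / n%:R)
        - \sum_(1 <= n < (Num.truncn x).+1) mangoldt n * psi (x / n%:R)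
       <= \sum_(1 <= n < (Num.truncn q).+1) mangoldt n * D n
          + 8 * z * (mert z - mert q).
  rewrite (@big_cat_nat _ _ _ (Num.truncn q).+1) ?ltnS ?le_truncn //=; last lra.
  rewrite [X in _ - X](@big_cat_nat _ _ _ (Num.truncn q).+1) ?ltnS ?le_truncn //=.
  rewrite opprD addrACA -sumrB; apply: lerD.
    by apply: ler_sum => n _; rewrite -mulrBr zn.
  rewrite -[X in _ <= X]subr0; apply: lerB; last first.
    by apply: sumr_ge0 => n _; rewrite mulr_ge0 ?mangoldt_ge0 ?psi_ge0.
  rewrite cumulB; last lra.
  rewrite mulr_sumr big_nat [X in _ <= X]big_nat.
  apply: ler_sum => n _; rewrite [X in _ <= X]mulrCA ler_wpM2l ?mangoldt_ge0 //.
  by rewrite -[8 * z / _]mulrA psi_le // divr_ge0 //; lra.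
(* For [n <= q] each [D n] obeys [BT], and every [n] counted by [W] falls short by a further
   [sig * x / n]. *)
have S2 : \sum_(1 <= n < (Num.truncn q).+1) mangoldt n * D n
       <= x * ((2 * (rho - 1) + 4 * eta) * mert q - sig * W).
  rewrite /mert /W /cumul !mulr_sumr -sumrB mulr_sumr big_nat [X in _ <= X]big_nat.
  apply: ler_sum => n /andP[n0]; rewrite ltnS truncn_ge_nat; last lra.
  move=> nq; have n0' : 0 < (n%:R : R) by rewrite ltr0n.
  have Yn : Y <= x / n%:R.
    by rewrite ler_pdivlMr // mulrC -ler_pdivlMr.
  rewrite -/(D n); case: ltP => Dn.
    rewrite [X in _ <= X](_ : _ = mangoldt n * (x / n%:R *
      (2 * (rho - 1) + 4 * eta - sig))); last by ring.
    rewrite ler_wpM2l ?mangoldt_ge0 //; apply: le_trans (ltW Dn) _.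
    by rewrite mulrC ler_wpM2l; lra.
  rewrite [X in _ <= X](_ : _ = mangoldt n * (x / n%:R *
      (2 * (rho - 1) + 4 * eta))); last by ring.
  rewrite ler_wpM2l ?mangoldt_ge0 //; apply: le_trans (BT _ _ Yn _) _.
    by rewrite ler_peMl; lra.
  have : eta * (rho * (x / n%:R)) <= eta * (4 * (x / n%:R)).
    by rewrite ler_pM2l // ler_wpM2r; lra.
  lra.
have W0 : 0 <= W by apply: cumul_ge0 => n; case: ifP => // _; apply: wt_ge0.
rewrite !ler_norml => /andP[sz _] /andP[_ sx].
have c0 : 0 <= 2 * (rho - 1) + 4 * eta by lra.
have S3 : (2 * (rho - 1) + 4 * eta) * mert q <= (2 * (rho - 1) + 4 * eta) * (ln x + 9).
  by rewrite ler_wpM2l //; lra.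
have S4 : 8 * z * (mert z - mert q) <= 8 * (4 * x) * (ln Y + 14).
  apply: ler_pM; try lra.
  by rewrite subr_ge0 ler_mert //; lra.
have S5 : (psi z - psi x) * ln z <= eta * x * (ln x + 3).
  apply: ler_pM => //; try lra.
  by rewrite subr_ge0 ler_psi.
have S6 : psi x * ln rho <= 8 * x * 3.
  by apply: ler_pM => //; rewrite ?psi_ge0 ?psi_le //; lra.
have S7 : 0 <= 2 * (z - x) * ln rho by rewrite mulr_ge0 //; lra.
have S8 : 0 <= 2 * x * ln rho by rewrite mulr_ge0 //; lra.
have S9 := ler_wpM2l (_ : 0 <= x) S3.
have {}S9 := S9 ltac:(lra).
rewrite -(ler_pM2l (_ : 0 < x)); last lra.
have xr : z = rho * x by [].
have S10 : eta * x <= x by rewrite ler_piMl; lra.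
rewrite lz in sz S5; move: sz sx S1 S2 S4 S5 S6 S7 S8 S9.
move: (\sum_(_ <= _ < _) _) (\sum_(_ <= _ < _) _) (\sum_(_ <= _ < _) _) => S T U.
rewrite xr; move: (psi _) (psi _) (ln x) (ln rho) (ln Y) (mert _) (mert _).
move=> *; lra.
Qed.

End Gaps.

(** * The density step: from width [6 h] to width [5 h] *)

Section GapStep.
Local Open Scope ring_scope.
Variable R : realType.
Implicit Types (d m n N p : nat) (a b x y z : R).
Local Notation mangoldt := (@mangoldt R).

(** If the whole of [(y, rho y]] has nearly the largest mass allowed, so does each part [(u, v]],
    because the two complementary pieces cannot exceed their own maximum. The factor 5 is 1 + 4,
    with [rho * y <= 4 * u]. *)
Lemma full_subinterval (rho eta sig Y y u v : R) :
    rho <= 4 -> 0 <= eta -> 0 <= sig -> 1 <= Y -> Y <= y ->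
    (forall a b, Y <= a -> a <= b -> psi b - psi a <= 2 * (b - a) + eta * b) ->
    (2 * (rho - 1) - sig) * y <= psi (rho * y) - psi y ->
    y <= u -> u <= v -> v <= rho * y ->
  2 * (1 - u / v) - (sig + 5 * eta) <= mert v - mert u.
Proof.
move=> rho4 eta0 sig0 Y1 Yy BT good yu uv vy.
have u0 : 0 < u by lra.
have v0 : 0 < v by lra.
apply: le_trans (psi_mert u0 uv); rewrite ler_pdivlMr //.
have h1 := BT y u Yy yu; have h2 := BT v (rho * y) ltac:(lra) vy.
rewrite mulrBl -mulrA mulrBl mul1r divfK ?gt_eqF //.
have ry : rho * y <= 4 * u.
  by apply: (@le_trans _ _ (4 * y)); rewrite ?ler_wpM2r; lra.
have : eta * (rho * y) <= eta * (4 * u) by rewrite ler_wpM2l.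
have : sig * y <= sig * v by rewrite ler_wpM2l //; lra.
have : eta * u <= eta * v by rewrite ler_wpM2l.
move: good; lra.
Qed.

(** Each unit shift telescopes to at most [G]. This limits how often a monotone [g] can grow by a
    fixed amount over [k] cells. *)
Lemma sum_shift_le (g : nat -> R) (G : R) (k a b : nat) :
    (forall i, 0 <= g i) -> (forall i, (i <= b + k)%N -> g i <= G) -> (a <= b)%N ->
  \sum_(a <= j < b) (g (j + k)%N - g j) <= k%:R * G.
Proof.
move=> g0 gG ab; elim: k gG => [|k IH] gG.
  by rewrite mul0r big1 // => j _; rewrite addn0 subrr.
under eq_bigr => j _.
  rewrite (_ : _ - _ = (g (j.+1 + k)%N - g (j + k)%N) + (g (j + k)%N - g j)).
    over.
  by rewrite addnS addSn; ring.
rewrite big_split /= telescope_sumr // -natr1 mulrDl mul1r addrC.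
apply: lerD; first by apply: IH => i ib; apply: gG; lia.
by have := g0 (a + k)%N; have := gG (b + k)%N ltac:(lia); lra.
Qed.

(* [m j] is the mass of the [j]-th cell: it is at least [c0] once a good point
   lies in cells [j+1], ..., [j+4].  Among the cells [j], [j+2], [j+4] at most
   one fails this when the windows of six cells from [j+1] and from [j+3] both
   contain a good point. *)
Lemma three_cells (good : nat -> Prop) (E m : nat -> R) (c0 : R) j :
    (forall i k, (i <= k)%N -> E i <= E k) -> (forall i, 0 <= m i) -> 0 <= c0 ->
    (forall i, (j <= i <= j + 4)%N ->
       (exists2 n, good n & E i.+1 < n%:R <= E (i + 5)%N) -> c0 <= m i) ->
    (exists2 n, good n & E j.+1 < n%:R <= E (j + 7)%N) ->
    (exists2 n, good n & E (j + 3)%N < n%:R <= E (j + 9)%N) ->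
  2 * c0 <= m j + m (j + 2)%N + m (j + 4)%N.
Proof.
move=> Emono m0 c00 cov [n gn /andP[n1 n2]] [p gp /andP[p1 p2]].
have := m0 j; have := m0 (j + 2)%N; have := m0 (j + 4)%N.
have [nE|nE] := leP n%:R (E (j + 5)%N).
  have h1 : c0 <= m j by apply: cov; [lia | exists n; rewrite ?n1].
  have [pE|pE] := leP p%:R (E (j + 7)%N).
    have : c0 <= m (j + 2)%N.
      apply: cov; first by lia.
      by exists p => //; rewrite -addnS -addnA p1.
    lra.
  have : c0 <= m (j + 4)%N.
    apply: cov; first by lia.
    exists p => //; rewrite -addnA p2 andbT; apply: le_lt_trans pE.
    by apply: Emono; lia.
  lra.
have h1 : c0 <= m (j + 2)%N.
  apply: cov; first by lia.
  exists n => //; rewrite -addnA n2 andbT; apply: le_lt_trans nE.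
  by apply: Emono; lia.
have : c0 <= m (j + 4)%N.
  apply: cov; first by lia.
  exists n => //; apply/andP; split; last first.
    by apply: le_trans n2 _; apply: Emono; lia.
  apply: le_lt_trans nE; apply: Emono; lia.
lra.
Qed.

(** The mass includes prime powers; these are removed only in [prime_in_short_interval]. *)
Definition dense_at (l : R) := exists d x0 : R, 0 < d /\
  forall x, x0 <= x -> d * x <= psi (expR l * x) - psi x.

(** Twelve factors 17/16 already exceed 2. In [dense_step] this turns [6 h <= ln 4] into
    [h <= 1/4]. *)
Lemma ln2_le_3_4 : ln (2 : R) <= 3 / 4.
Proof.
have h : ln (17 / 16 : R) <= 1 / 16 by apply: le_trans (ln_le_subr1 _) _; lra.
have : ln (2 : R) <= ln ((17 / 16) ^+ 12) by apply: ler_lnW; rewrite ?exprS; lra.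
rewrite lnXn ?divr_gt0 // -[X in _ <= X -> _]mulr_natr.
by move: (ln (17 / 16)) (ln 2) h => a b; lra.
Qed.

Lemma one_sub_expRN (h : R) : 0 < h <= 1 / 4 -> 4 / 5 * h <= 1 - expR (- h).
Proof.
move=> /andP[h0 h4]; have e1 := expR_ge1Dx h; have e0 := expR_gt0 h.
rewrite expRN -(ler_pM2r e0) mulrBl mul1r mulVf ?gt_eqF //.
have : 0 <= (expR h - (1 + h)) * (1 - 4 / 5 * h) by apply: mulr_ge0; lra.
have : 0 <= h * (1 / 4 - h) by apply: mulr_ge0; lra.
lra.
Qed.

(** Sum [three_cells] over [j]; [g i] stands for the bad weight up to [E i]. A window of six cells
    without good points raises [g] by at least [d], so adding [2 * c0 / d] times both window
    increments restores the bound in every case. [sum_shift_le] bounds each total increment by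
    [6 * G]. *)
Lemma window_counting (good : nat -> Prop) (E m g : nat -> R) (c0 d M G : R)
    (i0 J : nat) :
    (forall i k, (i <= k)%N -> E i <= E k) -> (forall i, 0 <= m i) ->
    0 <= c0 -> 0 < d -> (i0 <= J)%N ->
    (forall i, 0 <= g i) -> (forall i k, (i <= k)%N -> g i <= g k) ->
    (forall i, (i <= J + 9)%N -> g i <= G) ->
    (forall i, (i < J + 4)%N ->
       (exists2 n, good n & E i.+1 < n%:R <= E (i + 5)%N) -> c0 <= m i) ->
    (forall i, (i0 <= i)%N ->
       (forall n, E i < n%:R <= E (i + 6)%N -> ~ good n) ->
       d <= g (i + 6)%N - g i) ->
    (forall t, \sum_(i0 <= j < J) m (j + t)%N <= M) ->
  (J%:R - i0%:R) * (2 * c0) <= 3 * M + 24 * c0 / d * G.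
Proof.
move=> Emono m0 c00 d0 iJ g0 gmono gG cov winP summ.
have cd0 : 0 <= 2 * c0 / d by rewrite (divr_ge0 _ (ltW d0)) // mulr_ge0.
have cE : 2 * c0 / d * d = 2 * c0 by rewrite divfK ?gt_eqF.
have step j : (i0 <= j < J)%N -> 2 * c0 <= m (j + 0)%N + m (j + 2)%N + m (j + 4)%N
    + 2 * c0 / d * (g (j + 1 + 6)%N - g (j + 1)%N)
    + 2 * c0 / d * (g (j + 3 + 6)%N - g (j + 3)%N).
  move=> /andP[ij jJ]; rewrite addn0.
  have p1 : 0 <= 2 * c0 / d * (g (j + 1 + 6)%N - g (j + 1)%N).
    by rewrite mulr_ge0 // subr_ge0 gmono // leq_addr.
  have p3 : 0 <= 2 * c0 / d * (g (j + 3 + 6)%N - g (j + 3)%N).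
    by rewrite mulr_ge0 // subr_ge0 gmono // leq_addr.
  have p5 : 0 <= m j + m (j + 2)%N + m (j + 4)%N by rewrite !addr_ge0.
  have win i : (i0 <= i)%N -> (exists2 n, good n & E i < n%:R <= E (i + 6)%N) \/
      2 * c0 <= 2 * c0 / d * (g (i + 6)%N - g i).
    move=> i0i; case: (pselect (exists2 n, good n & E i < n%:R <= E (i + 6)%N)).
      by left.
    move=> ng; right; rewrite -{1}cE ler_wpM2l // winP // => n nE gn.
    by apply: ng; exists n.
  have [|w1|w1] := win (j + 1)%N; first by lia.
    have [|w3|w3] := win (j + 3)%N; first by lia.
      rewrite -addnA addn1 in w1; rewrite -addnA in w3.
      have := @three_cells good E m c0 j Emono m0 c00 _ w1 w3 => H.
      have := H (fun i ji => cov i ltac:(lia)).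
      move: p1 p3; clear; lra.
    move: w3 p1 p5; clear; lra.
  move: w1 p3 p5; clear; lra.
have : \sum_(i0 <= j < J) 2 * c0 <= \sum_(i0 <= j < J)
    (m (j + 0)%N + m (j + 2)%N + m (j + 4)%N
    + 2 * c0 / d * (g (j + 1 + 6)%N - g (j + 1)%N)
    + 2 * c0 / d * (g (j + 3 + 6)%N - g (j + 3)%N)).
  by rewrite big_nat [X in _ <= X]big_nat; apply: ler_sum.
rewrite [X in X <= _ -> _]sumr_const_nat -[X in X <= _ -> _]mulr_natl natrB //.
rewrite !big_split /= -!mulr_sumr.
have sumg t : (t <= 3)%N ->
    \sum_(i0 <= j < J) (g (j + t + 6)%N - g (j + t)%N) <= 6 * G.
  move=> t3; have := @sum_shift_le (fun i => g (i + t)%N) G 6 i0 J.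
  under eq_bigr do rewrite addnAC.
  by apply=> // i iJ6; apply: gG; lia.
have := summ 0%N; have := summ 2%N; have := summ 4%N.
have := ler_wpM2l cd0 (sumg 1%N isT); have := ler_wpM2l cd0 (sumg 3%N isT).
have -> : 24 * c0 / d * G = 2 * c0 / d * (6 * G) + 2 * c0 / d * (6 * G) by ring.
move: (\sum_(_ <= _ < _) _) (\sum_(_ <= _ < _) _) (\sum_(_ <= _ < _) _).
move: (\sum_(_ <= _ < _) _) (\sum_(_ <= _ < _) _) => g3 g1 m2 m4 m00.
move: (2 * c0 / d) (6 * G) (J%:R - i0%:R) => q G' j.
clear; lra.
Qed.

Definition grid (h : R) i := expR (i%:R * h).

Lemma grid_gt0 h i : 0 < grid h i. Proof. exact: expR_gt0. Qed.

Lemma ler_grid h i k : 0 < h -> (i <= k)%N -> grid h i <= grid h k.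
Proof. by move=> h0 ik; rewrite ler_expR ler_pM2r // ler_nat. Qed.

Lemma gridD h i k : grid h (i + k)%N = grid h i * grid h k.
Proof. by rewrite /grid natrD mulrDl expRD. Qed.

Lemma grid_div h i : grid h i / grid h i.+1 = expR (- h).
Proof. by rewrite -expRB; congr expR; rewrite -natr1; ring. Qed.

Lemma grid_ge (h y : R) : 0 < h -> exists i, y <= grid h i.
Proof.
move=> h0; exists (Num.truncn (`|y| / h)).+1.
have := truncnS_gt (`|y| / h); rewrite ltr_pdivrMr // => /ltW yh.
apply: le_trans (ler_norm _) (le_trans yh _).
by apply: le_trans (expR_ge1Dx _); move: (_ * h) => a; lra.
Qed.

(** The cell between [x / grid h j.+1] and [x / grid h j] lies inside [(x/n, rho x/n]], so
    [full_subinterval] applies. The constant is 31/20 = 8/5 - 1/40 - 1/40, from [one_sub_expRN],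
    [sig] and [5 * eta]. *)
Lemma full_cell (h rho eta sig Y x : R) n j :
    0 < h <= 1 / 4 -> rho = grid h 5 -> rho <= 4 ->
    0 <= eta <= h / 200 -> sig = h / 40 -> 1 <= Y -> 0 < x ->
    (forall a b, Y <= a -> a <= b -> psi b - psi a <= 2 * (b - a) + eta * b) ->
    (2 * (rho - 1) - sig) * (x / n%:R) <= psi (rho * (x / n%:R)) - psi (x / n%:R) ->
    grid h (j + 5) <= x / Y -> grid h j.+1 < n%:R <= grid h (j + 5) ->
  31 / 20 * h <= mert (x / grid h j) - mert (x / grid h j.+1).
Proof.
move=> /andP[h0 hq] rhoE rho4 /andP[eta0 eta2] sigE Y1 x0 BT good jY /andP[n1 n2].
have Y0 : 0 < Y by lra.
have Ej := grid_gt0 h j; have Ej1 := grid_gt0 h j.+1.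
have n0 : 0 < (n%:R : R) by apply: lt_trans n1.
have Yn : Y <= x / n%:R.
  by rewrite ler_pdivlMr // mulrC -ler_pdivlMr // (le_trans n2).
have y1 : x / n%:R <= x / grid h j.+1.
  by rewrite ler_pM2l // lef_pV2 ?posrE // ltW.
have y2 : x / grid h j <= rho * (x / n%:R).
  rewrite mulrCA ler_pM2l // ler_pdivlMr // mulrC ler_pdivrMr //.
  by rewrite rhoE mulrC -gridD.
have y3 : x / grid h j.+1 <= x / grid h j.
  by rewrite ler_pM2l // lef_pV2 ?posrE // ler_grid.
have sig0 : 0 <= sig by rewrite sigE divr_ge0 // ltW.
have := full_subinterval rho4 eta0 sig0 Y1 Yn BT good y1 y3 y2.
have -> : x / grid h j.+1 / (x / grid h j) = expR (- h).
  rewrite -(grid_div h j); move: (grid h j) (grid h j.+1) Ej Ej1 => a b a0 b0.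
  by field; rewrite !gt_eqF.
have := @one_sub_expRN h; rewrite h0 hq => /(_ isT).
move: (mert _) (mert _) (expR _) => a b c.
move: eta2 sigE; clear; lra.
Qed.

(** At a large [x] violating density at width [5 h], counting about [ln x / h] cells gives
    [31/10 * ln x] on the left against [3 * ln x] plus small terms from Mertens: a contradiction. *)
Lemma dense_step (h : R) : 0 < h -> 6 * h <= ln 4 ->
  dense_at (6 * h) -> dense_at (5 * h).
Proof.
move=> h0 h4 [d [x0 [d0 D]]].
have hq : h <= 1 / 4.
  move: h4; rewrite (_ : 4 = 2 * 2 :> R) ?lnM ?posrE //; last by ring.
  by have := ln2_le_3_4; lra.
pose E := grid h; have E0 := grid_gt0 h; have Emono i k := @ler_grid h i k h0.
have e6E : expR (6 * h) = E 6 by [].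
have e5E : expR (5 * h) = E 5 by [].
have rho4 : E 5 <= 4 by rewrite -e5E -[X in _ <= X]lnK ?posrE // ler_expR; lra.
have rho1 : 1 < E 5 by have := expR_ge1Dx (5 * h); rewrite -e5E; lra.
rewrite /dense_at e5E; rewrite e6E in D => {e5E e6E h4}.
set d' := d / E 6; have d'0 : 0 < d' by rewrite divr_gt0.
(* [h / 200] serves [full_cell]; [d' / 400 / 400] keeps the charge [1488 * 5 * eta / d' * ln x]
   below half of the surplus [ln x / 10]. *)
have [eta [eta0 eta1 eta2 eta3]] : exists eta : R,
    [/\ 0 < eta, eta <= 1, eta <= h / 200 & eta <= d' / 400 / 400].
  exists (Num.min 1 (Num.min (h / 200) (d' / 400 / 400))).
  by split; rewrite ?lt_min ?ge_min ?lexx ?orbT //= ltr01 !divr_gt0.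
have [Y Y1 BT] := brun_titchmarsh eta0.
have lY0 : 0 <= ln Y by rewrite ln_ge0.
have [i0 Ei0] := grid_ge x0 h0.
pose K := 32 * ln Y + 1015; have K0 : 0 <= K by rewrite /K; lra.
have cst1 : 0 <= K / d' by rewrite (divr_ge0 _ (ltW d'0)).
have cst2 : 0 <= h * i0%:R by rewrite (mulr_ge0 (ltW h0)).
(* All terms independent of [x]: the cells lost at both ends, three times the 9 of Mertens, and the
   constant part of the bad weight. The surplus left after the charge exceeds [ln x / 21]. *)
pose cst := 31 / 10 * (ln Y + h * (12 + i0%:R)) + 27 + 1488 * (K / d').
have cst0 : 0 <= cst by move: lY0 cst1 cst2 h0; rewrite /cst; clear; lra.
exists eta, (expR (21 * cst)); split => // x xX.
rewrite leNgt; apply/negP => /ltW gap.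
have x1 : 1 <= x.
  apply: le_trans xX; have := expR_ge1Dx (21 * cst); move: cst0; clear; lra.
have x0' : 0 < x by move: x1; clear; lra.
have Lx : 21 * cst <= ln x.
  by rewrite -[X in X <= _]expRK; apply: ler_lnW => //; apply: expR_gt0.
have Y0 : 0 < Y by move: Y1; clear; lra.
have Yx : Y <= x.
  rewrite -ler_ln ?posrE //.
  by move: Lx lY0 cst1 cst2 h0; rewrite /cst; clear; lra.
pose sig := h / 40; have sig0 : 0 < sig by rewrite divr_gt0.
have := @bad_weight R (E 5) eta sig Y x.
rewrite rho1 rho4 eta0 eta1 => /(_ isT isT sig0 Y1 Yx BT gap).
pose bad n := psi (E 5 * (x / n%:R)) - psi (x / n%:R)
              < (2 * (E 5 - 1) - sig) * (x / n%:R).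
set w := (X in cumul X); rewrite -/K => Wb.
have w0 n : 0 <= w n by rewrite /w; case: ifP => // _; apply: wt_ge0.
have q1 : 1 <= x / Y by rewrite ler_pdivlMr // mul1r.
have q0 : 0 < x / Y by rewrite divr_gt0.
have lq : ln (x / Y) = ln x - ln Y by rewrite ln_div ?posrE.
have t0 : 0 <= ln (x / Y) / h by rewrite (divr_ge0 _ (ltW h0)) // ln_ge0.
have /andP[r1 r2] := truncn_itv t0.
move: (Num.truncn (ln (x / Y) / h)) r1 r2 => r r1 r2.
rewrite ler_pdivlMr // in r1; rewrite ltr_pdivrMr // -natr1 in r2.
have Er : E r <= x / Y by rewrite -[X in _ <= X]lnK ?posrE ?ler_expR.
have ir : (i0 + 10 <= r)%N.
  rewrite -(ler_nat R) natrD -(ler_pM2r h0).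
  by move: Lx r2 lY0 cst1 cst2 h0; rewrite lq /cst; clear; lra.
have ir9 : (i0 <= r - 9)%N by move: ir; clear; lia.
have rr9 : (r - 9 + 9 <= r)%N by move: ir; clear; lia.
have E6 i : E (i + 6)%N = E 6 * E i by rewrite /E addnC gridD.
(* On a window of bad points [w] is the full Mertens weight. Density at width [6 h] gives mass
   [d * E i], each unit weighted by at least [1 / E (i + 6)]; hence [d' = d / E 6]. *)
have winP i : (i0 <= i)%N -> (forall n, E i < n%:R <= E (i + 6)%N -> ~ ~~ bad n) ->
    d' <= cumul w (E (i + 6)%N) - cumul w (E i).
  move=> i0i bw.
  have Ei6 : E i <= E (i + 6)%N by apply: Emono; rewrite leq_addr.
  have E60 : 0 < E (i + 6)%N by exact: E0.
  rewrite (@cumul_diff_eq _ w (fun n => mangoldt n / n%:R) _ _ (ltW (E0 i)) Ei6).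
    apply: le_trans (psi_mert (E0 i) Ei6).
    rewrite (ler_pdivlMr _ _ E60) E6 mulrA divfK ?gt_eqF ?E0 //.
    by apply: D; apply: le_trans Ei0 _; apply: Emono.
  by move=> n /bw /negP; rewrite negbK /bad /w => ->.
pose m j := mert (x / E j) - mert (x / E j.+1).
have xE i k : (i <= k)%N -> x / E k <= x / E i.
  by move=> ik; rewrite ler_pM2l // lef_pV2 ?posrE ?E0 // Emono.
have m0 j : 0 <= m j by rewrite subr_ge0 ler_mert // xE.
have c00 : 0 <= 31 / 20 * h by move: h0; clear; lra.
have cov j : (j + 5 <= r)%N ->
    (exists2 n, ~~ bad n & E j.+1 < n%:R <= E (j + 5)%N) -> 31 / 20 * h <= m j.
  move=> jr [n]; rewrite -leNgt => good nE.
  apply: (@full_cell h (E 5) eta sig Y x n j) => //; rewrite ?h0 ?(ltW eta0) //.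
  by apply: le_trans Er; apply: Emono.
have summ t : \sum_(i0 <= j < r - 9) m (j + t)%N <= ln x + 9.
  rewrite (eq_bigr (fun j => (- mert (x / E (j.+1 + t)%N)) - (- mert (x / E (j + t)%N)))).
    rewrite (telescope_sumr (fun j => - mert (x / E (j + t)%N)) ir9).
    have /andP[_ mx] := mert_bounds x1.
    have := mert_ge0 (x / E (r - 9 + t)%N).
    have : mert (x / E (i0 + t)%N) <= mert x.
      apply: ler_mert; rewrite ler_pdivrMr ?E0 // (ler_peMr (ltW x0')) //.
      have -> : 1 = E 0%N by rewrite /E /grid mul0r expR0.
      exact: Emono.
    by move: mx; clear; lra.
  by move=> j _; rewrite /m addSn; ring.
have := @window_counting (fun n => ~~ bad n) E m (fun i => cumul w (E i))
  (31 / 20 * h) d' (ln x + 9) (cumul w (x / Y)) i0 (r - 9)%N Emono m0 c00 d'0.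
move=> /(_ ir9 (fun i => cumul_ge0 _ w0)).
move=> /(_ (fun i k ik => ler_cumul w0 (Emono i k ik))).
have gG i : (i <= r - 9 + 9)%N -> cumul w (E i) <= cumul w (x / Y).
  move=> ir9'; apply: ler_cumul => //; apply: le_trans Er; apply: Emono.
  exact: leq_trans rr9.
have cov' i : (i < r - 9 + 4)%N -> (i + 5 <= r)%N.
  by move=> ir4; apply: leq_trans rr9; move: ir4; clear; lia.
move=> /(_ gG) /(_ (fun i ri => cov i (cov' i ri)) winP summ).
rewrite natrB; last by move: ir; clear; lia.
have W0 : 0 <= cumul w (x / Y) by exact: cumul_ge0.
(* Since [h = 40 * sig], the coefficient [24 * 31/20 * h] is [1488 * sig]. *)
have c1 : 24 * (31 / 20 * h) / d' * cumul w (x / Y)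
    <= 1488 * 5 * (eta / d' * ln x) + 1488 * (K / d').
  rewrite [X in X <= _](_ : _ = 1488 * (sig * cumul w (x / Y)) / d'); last first.
    by rewrite /sig; field; rewrite gt_eqF.
  rewrite ler_pdivrMr // [X in _ <= X](_ : _ = 1488 * (5 * eta * ln x + K)).
    by rewrite ler_pM2l.
  by field; rewrite gt_eqF.
have c2 : eta / d' * ln x <= 1 / 400 / 400 * ln x.
  rewrite ler_wpM2r ?ln_ge0 // ler_pdivrMr //; move: eta3; clear; lra.
move: c1 c2 Lx r2 lY0 cst1 cst2 h0; rewrite lq /cst.
move: (24 * _ / _ * _) => a; move: (eta / d' * _) => b.
move: (K / d') (ln x) (ln Y) => c e f.
by clear; move=> *; lra.
Qed.

End GapStep.

(** * Primes in short intervals *)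

Section PrimeGap.
Local Open Scope ring_scope.
Variable R : realType.
Implicit Types (d m n N p : nat) (a b x y z : R).
Local Notation mangoldt := (@mangoldt R).

(** [psi (4 x)] is at least about [4 * 7/12 * x], while [brun_titchmarsh] bounds [psi x] by about
    [(2 + 1/12) * x]. The margin [x / 4] absorbs the lower order terms. *)
Lemma dense_ln4 : dense_at (ln (4 : R)).
Proof.
have [Y Y1 BT] := @brun_titchmarsh R (1 / 12) ltac:(lra).
exists (1 / 8), (Num.max (128 * 128) (Num.max Y (16 * (8 * Y + 3)))); split; first lra.
move=> x; rewrite !ge_max lnK ?posrE // => /and3P[x1 Yx x2].
have s0 := sqrtr_ge0 x; have x0 : 0 <= x by lra.
have s1 : 128 <= Num.sqrt x.
  by rewrite -(@ler_sqr _ 128) ?nnegrE // sqr_sqrtr // expr2.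
have s2 : 128 * Num.sqrt x <= x.
  by rewrite -{2}(sqr_sqrtr x0) expr2 ler_wpM2r.
have p1 := BT Y x (lexx _) Yx.
have p2 : psi Y <= 8 * Y by apply: psi_le; lra.
have fx0 : 0 <= 4 * x by lra.
rewrite [psi (4 * x)]psiE; set N := Num.truncn (4 * x).
have /andP[n1 n2] := truncn_itv fx0; rewrite -/N -natr1 in n1 n2.
have N1 : (1 < N)%N by rewrite -(ltr_nat R); lra.
have := psin_ge_linear R N1.
have l1 : ln (N%:R : R) <= ln (4 * x) by apply: ler_lnW => //; lra.
have l2 : ln (4 * x) <= 4 * Num.sqrt x.
  apply: le_trans (ln_le_sqrt _) _; first lra.
  rewrite sqrtrM // (_ : Num.sqrt 4 = 2 :> R); first by lra.
  by rewrite (_ : 4 = 2 ^+ 2 :> R) ?sqrtr_sqr ?ger0_norm //; ring.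
have : N%:R * (7 / 12) <= N%:R * ln (2 : R) by rewrite ler_wpM2l // ln2_ge_7_12.
lra.
Qed.

Lemma dense_iter k : dense_at ((5 / 6) ^+ k * ln (4 : R)).
Proof.
have l4 : 0 < ln (4 : R) by rewrite ln_gt0 //; lra.
elim: k => [|k IH]; first by rewrite mul1r; exact: dense_ln4.
have q0 : 0 < (5 / 6 : R) ^+ k by rewrite exprn_gt0 //; lra.
have q1 : (5 / 6 : R) ^+ k <= 1 by apply: exprn_ile1; lra.
pose h := (5 / 6 : R) ^+ k * ln 4 / 6.
have h6 : 6 * h = (5 / 6) ^+ k * ln 4 by rewrite /h; field.
rewrite exprS (_ : _ * ln 4 = 5 * h); last by rewrite /h; field.
apply: dense_step; rewrite ?h6 //; first by rewrite divr_gt0 // mulr_gt0.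
by rewrite ler_piMl // ltW.
Qed.

Lemma dense_small (l : R) : 0 < l -> exists2 l', 0 < l' <= l & dense_at l'.
Proof.
move=> l0; have l4 : 0 < ln (4 : R) by rewrite ln_gt0 //; lra.
(* An explicit decay rate of the widths, from which [k] is read off. *)
have bern k : (5 / 6 : R) ^+ k * (5 + k%:R) <= 5.
  elim: k => [|k IH]; first by rewrite mul1r addr0.
  apply: le_trans IH; rewrite exprSr -mulrA ler_wpM2l ?exprn_ge0 //; first lra.
  by rewrite -natr1; have := ler0n R k; lra.
pose k := (Num.truncn (5 * ln 4 / l)).+1.
have kl : 5 * ln 4 / l <= k%:R by rewrite ltW // truncnS_gt.
exists ((5 / 6) ^+ k * ln 4); last exact: dense_iter.
move: k kl (bern k) => k kl bk.
have q0 : 0 < (5 / 6 : R) ^+ k by rewrite exprn_gt0 //; lra.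
rewrite mulr_gt0 //=; rewrite ler_pdivrMr // in kl.
have k5 : 0 < 5 + k%:R :> R by have := ler0n R k; lra.
rewrite -(ler_pM2r k5).
have := ler_wpM2r (ltW l4) bk; move: kl l0; move: (ln 4) (_ ^+ k) => a b.
have := ler0n R k; clear => *; lra.
Qed.

(** A proper power of [p] is [m ^ 2] or [m ^ 2 * p] with [m] a power of [p], and [p = pdiv m]. So
    each [m] up to the square root accounts for at most two values of [n]. *)
Lemma mangoldt_nonprime n : ~~ prime n -> mangoldt n != 0 ->
  exists2 m, (m ^ 2 <= n)%N & n = (m ^ 2)%N \/ n = (m ^ 2 * pdiv m)%N.
Proof.
case: mangoldtP => [p k pp ->|]; last by rewrite eqxx.
case: k => [|k]; first by rewrite expn1 pp.
move=> _ _; have p0 := prime_gt0 pp.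
exists (p ^ k.+2./2)%N; last first.
  rewrite -expnM muln2 -{1 3}(odd_double_half k.+2) expnD.
  case: (odd k.+2); last by left; rewrite mul1n.
  by right; rewrite /= (pdiv_pfactor _ pp) mulnC expn1.
by rewrite -expnM muln2 leq_pexp2l // -{2}(odd_double_half k.+2) leq_addl.
Qed.

Lemma sum_mangoldt_nonprime N :
  \sum_(1 <= n < N.+1 | ~~ prime n) mangoldt n <= 2 * Num.sqrt N%:R * ln N%:R.
Proof.
pose s := Num.truncn (Num.sqrt (N%:R : R)).
have sN : s%:R <= Num.sqrt (N%:R : R) by rewrite truncn_le sqrtr_ge0.
have l0 := lnn_ge0 R N.
pose u (c n : nat) : R := (n == c)%:R.
apply: (@le_trans _ _ (\sum_(1 <= n < N.+1) \sum_(1 <= m < s.+1)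
    (u (m ^ 2)%N n + u (m ^ 2 * pdiv m)%N n) * ln N%:R)).
  rewrite big_mkcond big_nat [X in _ <= X]big_nat; apply: ler_sum => n /andP[n0]; rewrite ltnS => nN.
  have T0 : 0 <= \sum_(1 <= m < s.+1) (u (m ^ 2)%N n + u (m ^ 2 * pdiv m)%N n) * ln N%:R.
    by apply: sumr_ge0 => m _; rewrite mulr_ge0 // addr_ge0.
  case: ifP => // np; have [->//|mn] := eqVneq (mangoldt n) 0.
  have [m mn2 mE] := mangoldt_nonprime np mn.
  have m0 : (0 < m)%N.
    by case: m mE {mn2} => // -[] nE; rewrite nE in n0.
  have ms : (m < s.+1)%N.
    rewrite ltnS truncn_ge_nat ?sqrtr_ge0 // -(@ler_sqr _ m%:R) ?nnegrE ?sqrtr_ge0 //.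
    by rewrite sqr_sqrtr // -natrX ler_nat (leq_trans mn2).
  rewrite (bigD1_seq m) ?iota_uniq ?mem_index_iota ?m0 //=.
  apply: (@le_trans _ _ ((u (m ^ 2)%N n + u (m ^ 2 * pdiv m)%N n) * ln N%:R)).
    apply: (le_trans (mangoldt_le R n)); apply: (le_trans (ler_lnn R nN)).
    rewrite ler_peMl // /u.
    by case: mE => <-; rewrite eqxx ?lerDl ?lerDr.
  by rewrite lerDl; apply: sumr_ge0 => i _; rewrite mulr_ge0 // addr_ge0.
have u1 c : \sum_(1 <= n < N.+1) u c n <= 1.
  have [cN|cN] := boolP (c \in index_iota 1 N.+1).
    rewrite (bigD1_seq c) ?iota_uniq //= /u eqxx big1 ?addr0 // => n.
    by move=> /negbTE ->.
  rewrite big_seq big1 // => n nN; rewrite /u; case: eqVneq => // nc.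
  by rewrite nc (negbTE cN) in nN.
rewrite exchange_big /=.
apply: (@le_trans _ _ (\sum_(1 <= m < s.+1) 2 * ln N%:R)).
  apply: ler_sum => m _; rewrite -mulr_suml ler_wpM2r // big_split /=.
  by have := u1 (m ^ 2)%N; have := u1 (m ^ 2 * pdiv m)%N; lra.
rewrite sumr_const_nat subSS subn0 -[X in X <= _]mulr_natl mulrCA mulrA.
by rewrite ler_wpM2r // ler_wpM2l.
Qed.

(** The mass [d * x] from [dense_small] exceeds the contribution [2 * sqrt z * ln z] of proper prime
    powers, so a prime remains. *)
Theorem prime_in_short_interval (e : R) : 0 < e ->
  exists x0 : R, forall x, x0 <= x -> exists2 p, prime p & x < p%:R <= (1 + e) * x.
Proof.
move=> e0; have l0 : 0 < ln (1 + Num.min e 3) by rewrite ln_gt0 // ltrDl lt_min e0; lra.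
have [l' /andP[l'0 l'l] [d [x0 [d0 D]]]] := dense_small l0.
have rl : expR l' <= 1 + Num.min e 3.
  by rewrite -[X in _ <= X]lnK ?posrE ?ler_expR // ltr_wpDl // lt_min e0; lra.
have r1 : 1 <= expR l' by have := expR_ge1Dx l'; lra.
have re : expR l' <= 1 + e by apply: le_trans rl _; rewrite lerD2l ge_min lexx.
have r4 : expR l' <= 4.
  apply: le_trans rl _; have : Num.min e 3 <= 3 by rewrite ge_min lexx orbT.
  by move: (Num.min e 3) => a; lra.
move: (expR l') D r1 re r4 => r D r1 re r4 {rl l'l l'0 l' l0}.
exists (Num.max x0 (Num.max 1 ((32 / d) ^+ 4 + 1))) => x.
rewrite !ge_max => /and3P[x0x x1 xd]; set z := r * x.
have xz : x <= z by rewrite ler_peMl //; lra.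
have z4 : z <= 4 * x by rewrite ler_wpM2r //; lra.
have ze : z <= (1 + e) * x by rewrite ler_wpM2r //; lra.
apply: contrapT => nop.
have := D x x0x; rewrite -/z leNgt => /negP; apply.
set N := Num.truncn z; have Nz : N%:R <= z by rewrite truncn_le; lra.
have N1 : 1 <= (N%:R : R) by rewrite ler1n truncn_gt0; lra.
apply: (@le_lt_trans _ _ (2 * Num.sqrt z * ln z)).
  rewrite cumulB //; apply: (@le_trans _ _ (2 * Num.sqrt N%:R * ln N%:R)); last first.
    apply: ler_pM; rewrite ?mulr_ge0 ?sqrtr_ge0 ?lnn_ge0 ?ler_wpM2l ?ler_wsqrtr //.
    by apply: ler_lnW => //; lra.
  apply: le_trans (sum_mangoldt_nonprime N).
  rewrite [X in _ <= X](@big_cat_nat _ _ _ (Num.truncn x).+1) ?ltnS ?le_truncn //=.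
  rewrite -[X in X <= _]add0r; apply: lerD.
    by apply: sumr_ge0 => n _; apply: mangoldt_ge0.
  rewrite [X in _ <= X]big_mkcond big_nat [X in _ <= X]big_nat.
  apply: ler_sum => n; rewrite mem_trunc_itv //; last lra.
  move=> /andP[xn nz]; case: ifP => // /negbFE pn; case: nop; exists n => //.
  by rewrite xn (le_trans nz ze).
have z0 : 0 < z by lra.
(* In terms of [u = z^(1/4)] the prime powers weigh at most [8 u^3], and [u > 32 / d] with
   [z <= 4 x] makes this less than [d * x]. *)
set u := Num.sqrt (Num.sqrt z).
have u0 : 0 < u by rewrite !sqrtr_gt0.
have u2 : u ^+ 2 = Num.sqrt z by rewrite sqr_sqrtr ?sqrtr_ge0.
have u4 : u ^+ 4 = z by rewrite (exprM u 2 2) u2 sqr_sqrtr ?ltW.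
have lz : ln z <= 4 * u.
  rewrite -u4 lnXn // -mulr_natl; have := ln_le_subr1 u0; lra.
have ud : 32 / d < u.
  rewrite -(@ltr_pXn2r _ 4) ?nnegrE ?ltW //; first by rewrite u4; lra.
  by rewrite divr_gt0.
rewrite ltr_pdivrMr // in ud; rewrite -u2.
apply: (@le_lt_trans _ _ (8 * u ^+ 3)).
  rewrite (_ : 8 * u ^+ 3 = 2 * u ^+ 2 * (4 * u)); last by ring.
  by rewrite ler_wpM2l // mulr_ge0 // exprn_ge0 // ltW.
have : 32 * u ^+ 3 < d * (4 * x).
  apply: (@lt_le_trans _ _ (d * z)); last by rewrite ler_pM2l.
  have -> : d * z = u * d * u ^+ 3 by rewrite -{1}u4; ring.
  by rewrite ltr_pM2r // exprn_gt0.
by rewrite mulrCA; lra.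
Qed.

End PrimeGap.

(** * Smooth blocks of consecutive integers *)

Section Blocks.
Local Open Scope ring_scope.
Variable R : realType.
Implicit Types (d m n N p q A x : nat).
Local Notation mangoldt := (@mangoldt R).
Local Notation psin := (@psin R).

Lemma sum_leq_bound N s : (\sum_(1 <= i < N.+1) (i <= s) <= s)%N.
Proof.
suff -> : (\sum_(1 <= i < N.+1) (i <= s) = minn N s)%N by exact: geq_minr.
elim: N => [|N IH]; first by rewrite big_geq // min0n.
by rewrite big_nat_recr //= IH; case: leqP; lia.
Qed.

Lemma logn_fact_widen p n N : prime p -> (n <= N)%N ->
  logn p n`! = (\sum_(1 <= i < N.+1) n %/ p ^ i)%N.
Proof.
move=> pp nN; rewrite logn_fact // [RHS](@big_cat_nat _ _ _ n.+1) //=.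
rewrite [X in (_ = _ + X)%N]big_nat [X in (_ = _ + X)%N]big1 ?addn0 //.
move=> i /andP[ni _]; rewrite divn_small //; apply: leq_trans (ltn_expl n (prime_gt1 pp)) _.
by rewrite leq_exp2l ?prime_gt1 // ltnW.
Qed.

(** By Legendre's formula the exponent counts the carries in [k + (n - k)] in base [p], and a carry
    at level [i] forces [p ^ i <= n]. *)
Lemma pfactor_bin_le p n k : prime p -> (0 < n)%N -> (k <= n)%N ->
  (p ^ logn p 'C(n, k) <= n)%N.
Proof.
move=> pp n0 kn.
suff : (logn p 'C(n, k) <= trunc_log p n)%N.
  by move=> h; apply: leq_trans (trunc_logP (prime_gt1 pp) n0); rewrite leq_exp2l ?prime_gt1.
apply: leq_trans (sum_leq_bound n _).
have := congr1 (logn p) (bin_fact kn).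
rewrite !lognM ?muln_gt0 ?fact_gt0 ?bin_gt0 //.
rewrite (logn_fact_widen pp kn) (logn_fact_widen pp (leq_subr k n)).
rewrite (logn_fact_widen pp (leqnn n)) -big_split /= => E.
rewrite -(leq_add2r (\sum_(1 <= i < n.+1) (k %/ p ^ i + (n - k) %/ p ^ i))) E -big_split /=.
apply: leq_sum => i _; have pi0 : (0 < p ^ i)%N by rewrite expn_gt0 prime_gt0.
rewrite -{1}(subnKC kn) divnD // [X in (_ <= X)%N]addnC leq_add2l.
case: (boolP (p ^ i <= _)%N) => // h; suff -> : (i <= trunc_log p n)%N by [].
apply: trunc_log_max (prime_gt1 pp) _; apply: leq_trans h _.
by rewrite -[X in (_ <= X)%N](subnKC kn) leq_add // leq_mod.
Qed.

Lemma ln_prod (I : eqType) (s : seq I) (f : I -> nat) :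
  {in s, forall i, (0 < f i)%N} ->
  ln ((\prod_(i <- s) f i)%N%:R : R) = \sum_(i <- s) ln (f i)%:R.
Proof.
elim: s => [|i s IH] f0; first by rewrite !big_nil ln1.
have fs : {in s, forall j, (0 < f j)%N} by move=> j js; apply: f0; rewrite inE js orbT.
rewrite !big_cons lnnM ?IH //; first by apply: f0; rewrite inE eqxx.
by rewrite big_seq; elim/big_rec: _ => // j x js; rewrite muln_gt0 fs.
Qed.

Lemma ln_sum_primes n : (0 < n)%N ->
  ln (n%:R : R) = \sum_(p <- primes n) (logn p n)%:R * ln p%:R.
Proof.
move=> n0; rewrite {1}(prod_prime_decomp n0) prime_decompE big_map /= ln_prod.
  rewrite big_seq [RHS]big_seq; apply: eq_bigr => p; rewrite mem_primes.
  by move=> /andP[/prime_gt0 p0 _]; rewrite natrX lnXn ?ltr0n // -[LHS]mulr_natl.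
by move=> p; rewrite mem_primes expn_gt0 => /andP[/prime_gt0 ->].
Qed.

(* [lrad A x] is [ln (rad x)] when every prime factor of [x] is at most [A] *)
Definition lrad A n : R := \sum_(1 <= p < A.+1 | prime p && (p %| n)%N) ln p%:R.

Lemma perm_primes_iota A n : (0 < n)%N -> (forall p, prime p -> (p %| n)%N -> (p <= A)%N) ->
  perm_eq (primes n) [seq p <- index_iota 1 A.+1 | prime p && (p %| n)%N].
Proof.
move=> n0 pA; apply: uniq_perm; rewrite ?primes_uniq ?filter_uniq ?iota_uniq //.
move=> p; rewrite mem_primes mem_filter mem_index_iota n0 /=.
case: (boolP (prime p)) => //= pp; case: (boolP (p %| n)%N) => //= pn.
by rewrite prime_gt0 // ltnS pA.
Qed.

Lemma rad_gt0 n : (0 < Defs.rad n)%N.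
Proof.
rewrite /Defs.rad big_seq; elim/big_rec: _ => // p x.
by rewrite mem_primes muln_gt0 => /andP[/prime_gt0 ->].
Qed.

Lemma ln_rad A n : (0 < n)%N -> (forall p, prime p -> (p %| n)%N -> (p <= A)%N) ->
  ln ((Defs.rad n)%:R : R) = lrad A n.
Proof.
move=> n0 pA; rewrite /Defs.rad ln_prod.
  by rewrite (perm_big _ (perm_primes_iota n0 pA)) big_filter.
by move=> p; rewrite mem_primes => /andP[/prime_gt0].
Qed.

Lemma lradM A m n : lrad A (m * n) <= lrad A m + lrad A n.
Proof.
rewrite /lrad !(big_mkcond (fun p => prime p && _)) -big_split /=.
apply: ler_sum => p _; case: (boolP (prime p)) => //= pp; last by rewrite addr0.
rewrite Euclid_dvdM //.
by case: (p %| m)%N; case: (p %| n)%N; rewrite /= ?addr0 ?add0r ?lerDl ?lnn_ge0.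
Qed.

(** The hypothesis for the triple [n], 1, [n + 1], in logarithmic form. *)
Lemma abc_consecutive A n : explicit_abc -> (0 < n)%N ->
    (forall p, prime p -> (p %| n * n.+1)%N -> (p <= A)%N) ->
  4 * ln n.+1%:R <= 7 * (lrad A n + lrad A n.+1).
Proof.
move=> abc n0 pA.
have n10 : (0 < n * n.+1)%N by rewrite muln_gt0 n0.
have h : (n.+1 ^ 4 < Defs.rad (n * n.+1) ^ 7)%N.
  have := abc n%:Z 1 n.+1%:Z.
  have -> : radz (n%:Z * 1 * n.+1%:Z) = Defs.rad (n * n.+1) by rewrite mulr1 /radz abszM.
  rewrite -!(rmorphXn Posz) ltz_nat; apply => //.
  by rewrite eqz_nat -lt0n.
  by rewrite /coprimez /gcdz /= gcdn1.
  by have := coprimenS n; rewrite /coprime /coprimez /gcdz /= => /eqP ->.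
  by rewrite /coprimez /gcdz /= gcd1n.
  by rewrite -PoszD addn1.
have := @ler_lnn R _ _ (ltnW h).
rewrite !natrX !lnXn ?ltr0n ?rad_gt0 // (ln_rad n10 pA).
rewrite -[_ *+ 4]mulr_natl -[_ *+ 7]mulr_natl => h'.
by have := lradM A n n.+1; lra.
Qed.

Lemma count_multiples m k p : (0 < p)%N ->
  (\sum_(m.+1 <= x < (m + k).+1) (p %| x) <= k %/ p + 1)%N.
Proof.
move=> p0; suff : (\sum_(m.+1 <= x < (m + k).+1) (p %| x) + m %/ p = (m + k) %/ p)%N.
  by rewrite divnD //; case: (p <= _)%N => /=; lia.
elim: k => [|k IH]; first by rewrite addn0 big_geq.
by rewrite addnS big_nat_recr /= ?ltnS ?leq_addr // divnS // -IH; lia.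
Qed.

(** Each [p <= A] divides at most [k %/ p + 1] integers of the block. The 1 sums to at most
    [psin A], and the quotients to at most [ln k!] by Legendre. *)
Lemma sum_lrad_block A m k :
  \sum_(m.+1 <= x < (m + k).+1) lrad A x <= psin A + ln k`!%:R.
Proof.
rewrite /lrad; under eq_bigr do rewrite big_mkcond.
rewrite exchange_big /=.
apply: (@le_trans _ _ (\sum_(1 <= p < A.+1) (mangoldt p + mangoldt p * (k %/ p)%N%:R))).
  rewrite big_nat [X in _ <= X]big_nat; apply: ler_sum => p /andP[p0 _].
  case: (boolP (prime p)) => pp /=; last first.
    by rewrite big1 // addr_ge0 ?mulr_ge0 ?mangoldt_ge0.
  rewrite mangoldt_prime // -[X in _ <= X + _]mulr1 -mulrDr.
  rewrite (eq_bigr (fun i => ln p%:R * (p %| i)%N%:R)); last first.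
    by move=> x _; case: (p %| x)%N; rewrite ?mulr1 ?mulr0.
  rewrite -mulr_sumr ler_wpM2l ?lnn_ge0 // -natr_sum addrC natr1 ler_nat.
  by have := count_multiples m k p0; rewrite addn1.
rewrite big_split lerD2l (ln_fact_mangoldt R (leq_maxr A k)).
rewrite [X in _ <= X](@big_cat_nat _ _ _ A.+1) ?ltnS ?leq_maxl //= lerDl.
by apply: sumr_ge0 => p _; rewrite mulr_ge0 ?mangoldt_ge0.
Qed.

Lemma ln_fact_le_mul k : ln (k`!%:R : R) <= k%:R * ln k%:R.
Proof.
rewrite ln_fact; apply: (@le_trans _ _ (\sum_(1 <= n < k.+1) ln k%:R)).
  rewrite big_nat [X in _ <= X]big_nat; apply: ler_sum => n /andP[_ nk].
  exact: ler_lnn.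
by rewrite sumr_const_nat subSS subn0 -[X in X <= _]mulr_natl.
Qed.

Lemma dvdn_ffact m k x : (m < x <= m + k)%N -> (x %| (m + k) ^_ k)%N.
Proof.
move=> /andP[mx xk]; rewrite ffact_prod.
have i_k : (m + k - x < k)%N by lia.
by rewrite (bigD1 (Ordinal i_k)) //= (_ : m + k - (m + k - x) = x)%N ?dvdn_mulr //; lia.
Qed.

Definition block_smooth m k A := forall p, prime p -> (p %| (m + k) ^_ k)%N -> (p <= A)%N.

Lemma block_smooth_dvd m k A x p : block_smooth m k A -> (m < x <= m + k)%N ->
  prime p -> (p %| x)%N -> (p <= A)%N.
Proof. by move=> bs mx pp px; apply: bs => //; apply: dvdn_trans px (dvdn_ffact mx). Qed.

(** Add abc over the [k - 1] consecutive pairs; each [x + 1] is at least [n / 2] since [k <= m]. By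
    [sum_lrad_block] the radicals total at most [14 * (8 A + k ln k)], whence 112 = 14 * 8; the two
    logarithmic hypotheses absorb [k ln k] and the loss from [ln 2]. *)
Lemma short_block m k A : explicit_abc -> (1 < k)%N -> (k <= m)%N ->
    block_smooth m k A -> 20 * ln (k%:R : R) <= ln (m + k)%N%:R ->
    5 <= ln ((m + k)%N%:R : R) ->
  k%:R * ln (m + k)%N%:R <= 112 * A%:R :> R.
Proof.
move=> abc k1 km bs k20 n5; set n := (m + k)%N in k20 n5 *.
have L : \sum_(m.+1 <= x < n) 4 * (ln n%:R - ln 2)
      <= \sum_(m.+1 <= x < n) 7 * (lrad A x + lrad A x.+1).
  rewrite big_nat [X in _ <= X]big_nat; apply: ler_sum => x /andP[mx xn].
  apply: le_trans (abc_consecutive abc _ _); last 2 first.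
    exact: leq_ltn_trans mx.
    move=> p pp; rewrite Euclid_dvdM // => /orP[] px.
      by apply: (block_smooth_dvd bs _ pp px); rewrite mx ltnW.
    by apply: (block_smooth_dvd bs _ pp px); rewrite (leq_trans mx).
  rewrite ler_pM2l // lerBlDr -lnM ?posrE ?ltr0n // -(natrM R _ 2) ler_lnn //.
  by rewrite /n; lia.
have S1 : \sum_(m.+1 <= x < n) lrad A x <= \sum_(m.+1 <= x < n.+1) lrad A x.
  rewrite [X in _ <= X]big_nat_recr ?lerDl ?sumr_ge0 //= ?/n; last by lia.
  by move=> p _; apply: lnn_ge0.
have S2 : \sum_(m.+1 <= x < n) lrad A x.+1 <= \sum_(m.+1 <= x < n.+1) lrad A x.
  rewrite -(big_add1 _ _ m.+1 n.+1 predT) [X in _ <= X]big_ltn ?lerDr ?sumr_ge0 //= ?/n; last by lia.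
  by move=> p _; apply: lnn_ge0.
have B := sum_lrad_block A m k; rewrite -/n in B.
move: L; rewrite sumr_const_nat -[X in X <= _]mulr_natl -mulr_sumr big_split /=.
have -> : (n - m.+1 = k.-1)%N by rewrite /n; lia.
have k2 : (k%:R : R) <= 2 * k.-1%:R by rewrite -(natrM R 2) ler_nat; lia.
have := psin_le_linear R A; have := ln_fact_le_mul k.
have k0 : 0 <= (k%:R : R) by [].
have := ler_wpM2l k0 k20; have := ler_wpM2l k0 n5.
have l2 : 0 <= ln (n%:R : R) - ln 2 by have := ln2_le_3_4 R; lra.
have := ler_wpM2r l2 k2.
have := ler_wpM2l k0 (ln2_le_3_4 R).
move: B S1 S2.
move: (\sum_(_ <= _ < _) _) (\sum_(_ <= _ < _) _) (\sum_(_ <= _ < _) _) => B C D.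
move: (ln n%:R) (ln 2) (ln k%:R) (ln k`!%:R) (psin A).
move: (k%:R : R) (k.-1%:R : R) (A%:R : R).
by clear => *; lra.
Qed.

Lemma fact_le_bound A (c : R) : (0 < A)%N -> ln (A`!%:R : R) <= c * A%:R ->
  A%:R <= expR (c + 1).
Proof.
move=> A0 h; have A0' : 0 < (A%:R : R) by rewrite ltr0n.
rewrite -[X in X <= _]lnK ?posrE // ler_expR -(ler_pM2l A0').
by have := ln_fact_ge R A; lra.
Qed.

(** Each prime contributes at most [ln n <= 20 ln k]. For [p > sqrt k] this is at most [40 ln p], in
    total [40 * psin A]; the at most [sqrt k] smaller primes give [40 k], by [ln k <= 2 sqrt k]. *)
Lemma ln_bin_le m k A : (1 < k)%N -> block_smooth m k A ->
    ln (m + k)%N%:R <= 20 * ln (k%:R : R) ->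
  ln ('C(m + k, k)%:R : R) <= 320 * A%:R + 40 * k%:R.
Proof.
move=> k1 bs k20; set n := (m + k)%N in k20 *.
have kn : (k <= n)%N by rewrite leq_addl.
have n0 : (0 < n)%N by apply: leq_trans kn; apply: ltnW.
have C0 : (0 < 'C(n, k))%N by rewrite bin_gt0.
have CA p : prime p -> (p %| 'C(n, k))%N -> (p <= A)%N.
  by move=> pp pC; apply: bs => //; rewrite -bin_ffact dvdn_mulr.
pose s := Num.truncn (Num.sqrt (k%:R : R)).
have sk : s%:R <= Num.sqrt (k%:R : R) by rewrite truncn_le sqrtr_ge0.
have lk0 := lnn_ge0 R k.
apply: (@le_trans _ _ (\sum_(1 <= p < A.+1) (40 * mangoldt p + (p <= s)%N%:R * (20 * ln k%:R)))).
  rewrite (ln_sum_primes C0) (perm_big _ (perm_primes_iota C0 CA)) big_filter.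
  rewrite big_mkcond big_nat [X in _ <= X]big_nat; apply: ler_sum => p /andP[p0 _].
  have T0 : 0 <= 40 * mangoldt p + (p <= s)%N%:R * (20 * ln k%:R).
    by rewrite addr_ge0 ?mulr_ge0 ?mangoldt_ge0.
  case: ifP => // /andP[pp pC].
  apply: (@le_trans _ _ (ln n%:R)).
    rewrite mulr_natl -lnXn ?ltr0n // -natrX; apply: ler_lnn.
    exact: pfactor_bin_le.
  apply: le_trans k20 _; rewrite mangoldt_prime //.
  have lp0 := lnn_ge0 R p.
  case: (boolP (p <= s)%N) => ps; first by rewrite mul1r lerDr mulr_ge0.
  rewrite mul0r addr0.
  have kp : ln (k%:R : R) <= 2 * ln p%:R.
    rewrite mulr_natl -lnXn ?ltr0n // -natrX ler_lnn //.
    move: ps; rewrite truncn_ge_nat ?sqrtr_ge0 // -ltNge => /ltW.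
    rewrite -(@ler_sqr _ (Num.sqrt _)) ?nnegrE ?sqrtr_ge0 // sqr_sqrtr //.
    by rewrite -natrX ler_nat.
  by lra.
rewrite big_split /= -mulr_sumr -mulr_suml -natr_sum.
have k0' : 0 < (k%:R : R) by rewrite ltr0n ltnW.
have c1 : (\sum_(1 <= p < A.+1) (p <= s))%N%:R <= Num.sqrt (k%:R : R).
  by apply: le_trans sk; rewrite ler_nat sum_leq_bound.
have c2 : (\sum_(1 <= p < A.+1) (p <= s))%N%:R * (20 * ln k%:R)
     <= Num.sqrt (k%:R : R) * (20 * (2 * Num.sqrt k%:R)).
  by apply: ler_pM; rewrite ?mulr_ge0 ?ler_pM2l // ln_le_sqrt.
have : Num.sqrt (k%:R : R) * Num.sqrt k%:R = k%:R by rewrite -expr2 sqr_sqrtr.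
have := psin_le_linear R A; move: c2; rewrite /psin.
move: (\sum_(_ <= _ < _) _) (_%:R * _) => a b.
by move: (Num.sqrt _) => d *; lra.
Qed.

(** If [A] were larger, [ln A] would exceed [ln k + 20 c + 1], and [A ln A - A <= ln A!] would
    surpass [20 c k ln k]. *)
Lemma long_block_smooth_le k A (c l : R) : (1 < k)%N -> (0 < A)%N -> 0 <= c ->
    l <= 20 * ln k%:R -> ln (A`!%:R : R) <= c * (k%:R * l) ->
  A%:R <= expR (20 * c + 1) * k%:R.
Proof.
move=> k1 A0 c0 lk h; rewrite leNgt; apply/negP => kA.
have k0 : 0 < (k%:R : R) by rewrite ltr0n ltnW.
have A0' : 0 < (A%:R : R) by rewrite ltr0n.
have e1 : 20 * c <= expR (20 * c + 1) by have := expR_ge1Dx (20 * c + 1); lra.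
have lA : ln k%:R + (20 * c + 1) < ln (A%:R : R).
  have := kA; rewrite -ltr_ln ?posrE ?mulr_gt0 ?expR_gt0 //.
  by rewrite lnM ?posrE ?expR_gt0 // expRK addrC.
have lk0 := lnn_ge0 R k.
have h1 : c * (k%:R * l) <= 20 * c * k%:R * ln k%:R.
  rewrite [X in _ <= X](_ : _ = c * (k%:R * (20 * ln k%:R))); last by ring.
  by rewrite !ler_wpM2l // ltW.
have h2 : 20 * c * k%:R * ln k%:R <= A%:R * ln k%:R.
  rewrite ler_wpM2r //; apply: le_trans (ltW kA).
  by rewrite ler_wpM2r // ltW.
have h3 : A%:R * (ln k%:R + 20 * c + 1) < A%:R * ln (A%:R : R).
  by rewrite ltr_pM2l // -addrA.
have h4 : 0 <= A%:R * c by rewrite mulr_ge0.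
have := ln_fact_ge R A; lra.
Qed.

Lemma expn_le_ffact m k : (m ^ k <= (m + k) ^_ k)%N.
Proof.
elim: k => // k IH; rewrite addnS ffactSS expnS leq_mul //.
by rewrite leqW // leq_addr.
Qed.

(* An [A]-smooth block with [A] at most linear in [k] has its binomial coefficient at most
   exponential in [k], hence [m] at most linear in [k]. *)
Lemma long_block m k A (c : R) : (1 < k)%N -> (0 < m)%N -> block_smooth m k A ->
    ln (m + k)%N%:R <= 20 * ln (k%:R : R) -> A%:R <= c * k%:R ->
  m%:R <= expR (320 * c + 40) * k%:R.
Proof.
move=> k1 m0 bs k20 Ac.
have k0 : 0 < (k%:R : R) by rewrite ltr0n ltnW.
have m0' : 0 < (m%:R : R) by rewrite ltr0n.
have C0 : (0 < 'C(m + k, k))%N by rewrite bin_gt0 leq_addl.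
have h1 := ln_bin_le k1 bs k20.
have h2 : k%:R * ln m%:R <= ln ('C(m + k, k)%:R : R) + k%:R * ln k%:R.
  apply: (@le_trans _ _ (ln ('C(m + k, k)%:R : R) + ln k`!%:R)); last first.
    by rewrite lerD2l ln_fact_le_mul.
  rewrite -lnnM ?fact_gt0 // bin_ffact mulr_natl -lnXn // -natrX ler_lnn //.
  exact: expn_le_ffact.
rewrite -[X in X <= _]lnK ?posrE // -[X in _ * X]lnK ?posrE // -expRD ler_expR.
rewrite -(ler_pM2l k0); lra.
Qed.

Theorem factorial_block_bounded (C : nat) : explicit_abc -> exists B : nat,
  forall m k A, (1 < k)%N -> (0 < m)%N -> (0 < A)%N -> (A <= m)%N ->
    block_smooth m k A -> (A`! <= (m + k) ^ (C * k))%N -> (m + k <= B)%N.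
Proof.
move=> abc.
(* [B1] settles short blocks, where [ln A! <= c1 * A] bounds [A] and [ln n <= 112 * A]. In long
   blocks [A <= c3 * k] and then [m <= M * k]. *)
pose c1 : R := 112 * C%:R; pose B1 := expR (112 * expR (c1 + 1)).
pose c3 : R := expR (20 * C%:R + 1); pose M := expR (320 * c3 + 40).
have M0 : 0 < M by exact: expR_gt0.
have [x0 gap] := @prime_in_short_interval R M^-1 ltac:(by rewrite invr_gt0).
pose X := Num.max x0 0.
pose B2 := (1 + M^-1) * X.
exists (maxn (Num.truncn (expR 5 : R)) (maxn (Num.truncn B1) (Num.truncn B2))).+1.
move=> m k A k1 m0 A0 Am bs AC.
have k0 : 0 < (k%:R : R) by rewrite ltr0n ltnW.
have m0' : 0 < (m%:R : R) by rewrite ltr0n.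
set n := (m + k)%N in AC *; have n0 : (0 < n)%N by rewrite addn_gt0 m0.
have n0' : 0 < (n%:R : R) by rewrite ltr0n.
have leB (b : R) : n%:R <= b -> (n <= (Num.truncn b))%N.
  by move=> nb; rewrite truncn_ge_nat // (le_trans _ nb) // ltW.
have lA : ln (A`!%:R : R) <= C%:R * (k%:R * ln n%:R).
  have := ler_lnn R AC; rewrite natrX lnXn // -[X in _ <= X -> _]mulr_natl natrM.
  by rewrite mulrA.
have [k20|/ltW k20] := leP (20 * ln (k%:R : R)) (ln n%:R).
  have [n5|/ltW n5] := leP 5 (ln (n%:R : R)); last first.
    apply: leqW; rewrite !leq_max leB //.
    by rewrite -[X in X <= _]lnK ?posrE // ler_expR.
  have km : (k <= m)%N.
    have : ln ((k * k)%N%:R : R) <= ln n%:R.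
      by rewrite lnnM ?(ltnW k1) //; have := lnn_ge0 R k; lra.
    by rewrite ler_ln ?posrE ?ltr0n ?muln_gt0 ?(ltnW k1) // ler_nat /n; nia.
  have sb := short_block abc k1 km bs k20 n5; rewrite -/n in sb.
  have A1 : A%:R <= expR (c1 + 1).
    apply: fact_le_bound => //; apply: le_trans lA _.
    by rewrite /c1 [112 * _]mulrC -mulrA ler_wpM2l.
  apply: leqW; rewrite !leq_max (leB B1) ?orbT //.
  rewrite -[X in X <= _]lnK ?posrE // ler_expR.
  apply: le_trans (le_trans sb _); last by rewrite ler_pM2l.
  by rewrite ler_peMl ?lnn_ge0 // ler1n ltnW.
have Ak : A%:R <= c3 * k%:R by exact: long_block_smooth_le lA.
have mk := long_block k1 m0 bs k20 Ak; rewrite -/M in mk.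
(* Such a prime divides the block but exceeds [m >= A]. Since [m <= M * k], the block contains
   [(m, (1 + 1/M) m]]. *)
have noprime p : prime p -> (m < p <= n)%N -> False.
  move=> pp mp; have := block_smooth_dvd bs mp pp (dvdnn p).
  by have /andP[] := mp; lia.
have [mX|Xm] := leP X m%:R.
  have [|p pp /andP[mp pm]] := gap m%:R; first by apply: le_trans mX; rewrite le_max lexx.
  case: (noprime p pp); rewrite -!(ltr_nat R) mp /= -(ler_nat R) (le_trans pm) //.
  by rewrite mulrDl mul1r natrD lerD2l mulrC ler_pdivrMr // mulrC.
have [nB|/ltW Bn] := leP (n%:R : R) B2.
  by apply: leqW; rewrite !leq_max (leB B2) ?orbT.
(* Here [m] is below the threshold for [gap], so the prime is found just above [X], still inside the
   block because [n >= B2]. *)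
have [|p pp /andP[mp pm]] := gap X; first by rewrite le_max lexx.
case: (noprime p pp); rewrite -(ltr_nat R) -(ler_nat R) (lt_trans Xm mp) /=.
exact: le_trans pm Bn.
Qed.

End Blocks.

(** * Reduction of the factorial equation *)

Section Reduction.
Implicit Types (a n : seq nat) (s t l : nat).

Lemma nonincr_le (f : nat -> nat) t : (forall l, 1 <= l -> l < t -> f l.+1 <= f l) ->
  forall l l', 1 <= l -> l <= l' -> l' <= t -> f l' <= f l.
Proof.
move=> fS l l' l1 /subnK <-; elim: (l' - l) => // d IH dt.
rewrite addSn in dt *; apply: leq_trans (fS _ _ dt) (IH (ltnW dt)).
by rewrite addn_gt0 l1 orbT.
Qed.

Lemma prime_dvd_fact p m : prime p -> p %| m`! -> p <= m.
Proof.
move=> pp; elim: m => [|m IH]; first by rewrite dvdn1 => /eqP p1; rewrite p1 in pp.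
by rewrite factS Euclid_dvdM // => /orP[/dvdn_leq ->//|/IH/leqW].
Qed.

Lemma prime_dvd_prod (I : eqType) (r : seq I) (F : I -> nat) p : prime p ->
  p %| \prod_(i <- r) F i -> exists2 i, i \in r & p %| F i.
Proof.
move=> pp; elim: r => [|i r IH]; first by rewrite big_nil dvdn1 => /eqP p1; rewrite p1 in pp.
rewrite big_cons Euclid_dvdM // => /orP[pi|/IH[j jr pj]].
  by exists i; rewrite ?inE ?eqxx.
by exists j; rewrite ?inE ?jr ?orbT.
Qed.

Lemma seq_argmax (I : eqType) (r : seq I) (F : I -> nat) : r != [::] ->
  exists2 i, i \in r & forall j, j \in r -> F j <= F i.
Proof.
elim: r => // i r IH _; have [->|/IH[j jr Fj]] := eqVneq r [::].
  by exists i => [|j]; rewrite ?inE ?eqxx // => /eqP ->.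
have [Fij|/ltnW Fji] := leqP (F i) (F j).
  by exists j; rewrite ?inE ?jr ?orbT // => x /orP[/eqP ->|/Fj].
exists i; rewrite ?inE ?eqxx // => x; rewrite inE => /orP[/eqP ->//|/Fj xj].
exact: leq_trans xj Fji.
Qed.

Lemma ffact_le_expn m k : m ^_ k <= m ^ k.
Proof.
elim: k m => // k IH [|m]; first by rewrite ffact0n.
rewrite ffactSS expnS leq_mul //; apply: leq_trans (IH m) _.
by case: k {IH} => // k; rewrite leq_exp2r.
Qed.

Lemma prod_at1 a (F : nat -> nat) :
  \prod_(x <- a) F x = \prod_(l <- iota 1 (size a)) F (at1 a l).
Proof.
rewrite (big_nth 0) -[in RHS](addn0 1) iotaDl big_map /index_iota subn0.
exact: eq_bigr.
Qed.

(** Cancelling the matched factorials leaves the unmatched [a_l!] equal to a product of blocks, the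
    first of which is fed to [factorial_block_bounded]. The bound is uniform in [i]. *)
Lemma solution_bounded (s t c : nat) : explicit_abc -> 2 < s -> s < t -> exists B,
  forall i a n, valid_indices s t i -> in_Nc_i s t c i a n ->
    at1 a 1 <= B /\ at1 n 1 <= B.
Proof.
move=> abc s2 st.
have [B HB] := @factorial_block_bounded Rdefinitions.R ((c + 1) * s) abc.
exists B => i a n [i_rng i_inj] [] [[sa sn] [a_dec a_t] [n_dec n_s] a_n E] ntriv a1n1 ain kc.
have aD := nonincr_le a_dec; have nD := nonincr_le n_dec.
suff h : at1 n 1 <= B by split=> //; apply: leq_trans (ltnW a1n1) h.
have k1E : at1 a 1 + kk1 a n = at1 n 1 by rewrite /kk1 subnKC // ltnW.
(* Nontriviality at the pair [(1, 1)] excludes a block of a single integer. *)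
have k2 : 1 < kk1 a n.
  by have [_] := ntriv 1 1 ltac:(lia) ltac:(lia); rewrite /kk1; lia.
pose i' j := if j == 1 then 1 else i j.
have i'_rng j : j \in iota 1 s -> i' j \in iota 1 t.
  rewrite !mem_iota /i' => js; case: eqVneq => [_|j1]; first by lia.
  by have := i_rng j ltac:(lia); lia.
have i'_inj : {in iota 1 s &, injective i'}.
  move=> j j'; rewrite !mem_iota /i' => js js'.
  case: (eqVneq j 1) => [->|j1]; case: (eqVneq j' 1) => [->//|j'1].
  by have := i_rng j' ltac:(lia); lia.
  by have := i_rng j ltac:(lia); lia.
  by apply: i_inj; lia.
pose idx := [seq i' j | j <- iota 1 s].
have idx_uniq : uniq idx by rewrite map_inj_in_uniq // iota_uniq.
pose rest := [seq l <- iota 1 t | l \notin idx].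
have perm_t : perm_eq (iota 1 t) (idx ++ rest).
  apply: uniq_perm; rewrite ?iota_uniq // ?cat_uniq ?idx_uniq ?filter_uniq ?iota_uniq //.
    by rewrite andbT; apply/hasPn => l; rewrite mem_filter => /andP[].
  move=> l; rewrite mem_cat mem_filter; case: (boolP (l \in idx)) => //= /mapP[j js ->].
  exact: i'_rng.
have rest0 : rest != [::].
  apply/eqP => r0; have := perm_size perm_t.
  by rewrite r0 cats0 size_map !size_iota; lia.
pose kj j := at1 n j - at1 a (i' j).
have a_lt j : j \in iota 1 s -> at1 a (i' j) < at1 n j.
  by rewrite mem_iota /i' => js; case: eqVneq => [->//|j1]; apply: ain; lia.
have Erest : \prod_(l <- rest) (at1 a l)`! = \prod_(j <- iota 1 s) at1 n j ^_ kj j.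
  move: E; rewrite !(prod_at1 _ factorial) sa sn (perm_big _ perm_t) big_cat big_map /=.
  rewrite [X in _ = X](eq_big_seq (fun j => at1 n j ^_ kj j * (at1 a (i' j))`!)).
    rewrite big_split /= mulnC => /eqP; rewrite eqn_pmul2r => [/eqP //|].
    by rewrite big_seq; elim/big_rec: _ => // j x _ x0; rewrite muln_gt0 fact_gt0.
  move=> j js /=; rewrite -(@ffact_fact (at1 n j) (kj j)) ?leq_subr //.
  by rewrite /kj subKn // ltnW // a_lt.
have [l0 l0r l0max] := seq_argmax (at1 a) rest0.
have l0t : 1 <= l0 <= t.
  by move: l0r; rewrite mem_filter mem_iota => /andP[_]; lia.
have A2 l : 1 <= l <= t -> 2 <= at1 a l.
  by move=> /andP[l1 lt]; apply: leq_trans a_t _; apply: aD.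
have Aa : at1 a l0 <= at1 a 1 by apply: aD; lia.
rewrite -k1E; apply: HB (k2) _ _ Aa _ _.
by have := A2 1 ltac:(lia); lia.
by have := A2 l0 l0t; lia.
(* A prime of the first block divides some unmatched [a_l!], hence is at most the largest unmatched
   [a_l]. *)
move=> p pp; rewrite k1E => pd.
  have : p %| \prod_(l <- rest) (at1 a l)`!.
    rewrite Erest (bigD1_seq 1) ?iota_uniq ?mem_iota //=; last by lia.
    by rewrite dvdn_mulr.
  move=> /(prime_dvd_prod pp)[l lr /(prime_dvd_fact pp) pl].
  exact: leq_trans pl (l0max l lr).
(* Each of the [s] blocks has length at most [(c + 1) * k_1], where the [+ 1] covers the first, and
   entries at most [n_1]. *)
rewrite k1E; apply: (@leq_trans (\prod_(l <- rest) (at1 a l)`!)).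
  rewrite (bigD1_seq l0) ?filter_uniq ?iota_uniq //=.
  rewrite leq_pmulr // big_seq_cond.
  by elim/big_rec: _ => // j x _ x0; rewrite muln_gt0 fact_gt0.
rewrite Erest; apply: (@leq_trans (\prod_(j <- iota 1 s) at1 n 1 ^ ((c + 1) * kk1 a n))).
  rewrite big_seq [X in _ <= X]big_seq; apply: leq_prod => j js.
  apply: leq_trans (ffact_le_expn _ _) _.
  have n1j : at1 n j <= at1 n 1 by move: js; rewrite mem_iota => js; apply: nD; lia.
  apply: (@leq_trans (at1 n 1 ^ kj j)); first by case: (kj j) => // k; rewrite leq_exp2r.
  rewrite leq_pexp2l //; first by lia.
  rewrite /kj /i'; move: js; rewrite mem_iota; case: eqVneq => [-> _|j1 js].
    by rewrite -/(kk1 a n); lia.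
  have : kkj i a n j <= kk s i a n.
    by apply: (leq_bigmax_seq (F := kkj i a n)) => //; rewrite mem_index_iota; lia.
  by rewrite /kkj; lia.
by rewrite big_const_seq count_predT size_iota iter_muln_1 -expnM mulnAC.
Qed.

(** * Finiteness from boundedness *)

Fixpoint bounded_seqs (b m : nat) : seq (seq nat) :=
  if m is m'.+1 then [seq x :: y | x <- iota 0 b.+1, y <- bounded_seqs b m'] else [:: [::]].

Lemma mem_bounded_seqs b m y : size y = m -> (forall k, k < m -> nth 0 y k <= b) ->
  y \in bounded_seqs b m.
Proof.
elim: m y => [|m IH] [|x y] // [sy] yb.
suff : x :: y \in [seq u :: v | u <- iota 0 b.+1, v <- bounded_seqs b m] by [].
apply: allpairs_f; first by rewrite mem_iota ltnS (yb 0).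
by apply: IH => // k km; apply: (yb k.+1).
Qed.

Lemma finite_pairs_bounded (P : seq nat -> seq nat -> Prop) (s t B : nat) :
  (forall a n, P a n -> [/\ size a = t, size n = s,
     forall k, k < t -> nth 0 a k <= B & forall k, k < s -> nth 0 n k <= B]) ->
  finite_pairs P.
Proof.
move=> H; exists [seq (a, n) | a <- bounded_seqs B t, n <- bounded_seqs B s] => a n.
by move=> /H[sa sn aB nB]; apply: allpairs_f; apply: mem_bounded_seqs.
Qed.

End Reduction.

Theorem theorem1p2 :
  explicit_abc ->
  forall s t c : nat, 2 < s -> s < t -> 0 < c ->
    (forall i : nat -> nat, valid_indices s t i ->
       finite_pairs (in_Nc_i s t c i)) /\
    finite_pairs (in_Nc s t c).
Proof.
move=> abc s t c s2 st c0.
have [B HB] := solution_bounded c abc s2 st.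
(* The union comes first, as the bound does not depend on [i]; each single set is contained in
   it. *)
have fin : finite_pairs (in_Nc s t c).
  apply: (@finite_pairs_bounded _ s t B) => a n [i [vi sol]].
  have [aB nB] := HB i a n vi sol.
  case: sol => -[[sa sn] [a_dec _] [n_dec _] _ _] _ _ _ _; split=> // k kt.
    apply: leq_trans aB; exact: (nonincr_le a_dec (l := 1) (l' := k.+1)).
  apply: leq_trans nB; exact: (nonincr_le n_dec (l := 1) (l' := k.+1)).
split=> // i vi; have [L HL] := fin; exists L => a n sol.
by apply: HL; exists i.
Qed.
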